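(* Let $\Lambda\ge\lambda>0$ and set $\omega=\Lambda/\lambda\ge 1$. For $\frac{1}{\sqrt\omega}\le\gamma\le\sqrt\omega$ define the even function $\phi^\omega_\gamma$ on $|x|\le \frac{\pi}{2}+\sqrt\omega\arcsin\left(\frac{1}{\gamma\sqrt\omega}\right)$ by $$\phi^\omega_\gamma(x)=\begin{cases}\frac{\pi}{2}+\sqrt\omega\arcsin\left(\frac{\gamma}{\sqrt\omega}\cos x\right) & |x|\le\frac{\pi}{2},\\[1ex] \arccos\left(\gamma\sqrt\omega\,\sin\left(\frac{|x|-\pi/2}{\sqrt\omega}\right)\right) & \frac{\pi}{2}<|x|\le\frac{\pi}{2}+\sqrt\omega\arcsin\left(\frac{1}{\gamma\sqrt\omega}\right),\end{cases}$$ and let $\Omega^\omega_\gamma=\{(x,y)\in\mathbb{R}^2: |y|<\phi^\omega_\gamma(x)\}$. Then the positive principal eigenvalue of $\mathcal{M}^+_{\lambda,\Lambda}$ in $\Omega^\omega_\gamma$ is $\mu(\Omega^\omega_\gamma)=\lambda$, and the principal eigenfunction is, up to positive multiplicative constants, $$u^\omega_\gamma(x,y)=\begin{cases}\gamma\cos x+\cos y & |x|\le\frac{\pi}{2},\ |y|\le\frac{\pi}{2},\\[1ex] \gamma\sqrt\omega\cos\left(\frac{|x|-\pi/2}{\sqrt\omega}+\frac{\pi}{2}\right)+\cos y & (x,y)\in\Omega^\omega_\gamma,\ |x|\ge\frac{\pi}{2},\\[1ex] \gamma\cos x+\sqrt\omega\cos\left(\frac{|y|-\pi/2}{\sqrt\omega}+\frac{\pi}{2}\right)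 & (x,y)\in\Omega^\omega_\gamma,\ |y|\ge\frac{\pi}{2}.\end{cases}$$
   Context: For $0<\lambda\le\Lambda$, the Pucci supremum operator is defined on $2\times 2$ real symmetric matrices $X$ by $\mathcal{M}^+_{\lambda,\Lambda}(X)=\lambda\sum_{e_i<0}e_i+\Lambda\sum_{e_i>0}e_i$, where $e_i$ are the eigenvalues of $X$. For a bounded Lipschitz domain $\Omega$, the positive principal eigenvalue is $\mu(\Omega)=\mu^+(\Omega)=\sup\{\mu\in\mathbb{R}:\exists\,\phi>0\text{ in }\Omega,\ \mathcal{M}^+_{\lambda,\Lambda}(D^2\phi)+\mu\phi\le 0\text{ in }\Omega\}$ (in the viscosity sense); a principal eigenfunction is a $\phi>0$ in $\Omega$ with $\mathcal{M}^+_{\lambda,\Lambda}(D^2\phi)+\mu(\Omega)\phi=0$ in $\Omega$, $\phi=0$ on $\partial\Omega$. *)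

(* Defs.v *)
From Stdlib Require Import Reals.
From Coquelicot Require Import Coquelicot.
Open Scope R_scope.

Definition dist2 (x y x0 y0 : R) : R := sqrt ((x - x0)^2 + (y - y0)^2).

(** Pucci supremum operator on the 2x2 symmetric matrix [[a, b],[b, c]].
    Its eigenvalues are the two roots of the characteristic polynomial
    t^2 - (a+c) t + (ac - b^2), i.e. (a+c)/2 -+ sqrt(((a-c)/2)^2 + b^2). *)
Definition eig_lo (a b c : R) : R := (a + c) / 2 - sqrt (((a - c) / 2)^2 + b^2).
Definition eig_hi (a b c : R) : R := (a + c) / 2 + sqrt (((a - c) / 2)^2 + b^2).
Definition pucci_term (lam Lam e : R) : R :=
  if Rlt_dec e 0 then lam * e else if Rlt_dec 0 e then Lam * e else 0.
Definition pucci_plus (lam Lam a b c : R) : R :=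
  pucci_term lam Lam (eig_lo a b c) + pucci_term lam Lam (eig_hi a b c).

Definition dx (f : R -> R -> R) (x y : R) : R := Derive (fun t => f t y) x.
Definition dy (f : R -> R -> R) (x y : R) : R := Derive (fun t => f x t) y.

Definition cont2_at (g : R -> R -> R) (x0 y0 : R) : Prop :=
  forall eps, 0 < eps -> exists del, 0 < del /\
    forall x y, dist2 x y x0 y0 < del -> Rabs (g x y - g x0 y0) < eps.

Definition C2 (f : R -> R -> R) : Prop :=
  forall x y,
    ex_derive (fun t => f t y) x /\ ex_derive (fun t => f x t) y /\
    ex_derive (fun t => dx f t y) x /\ ex_derive (fun t => dx f x t) y /\
    ex_derive (fun t => dy f t y) x /\ ex_derive (fun t => dy f x t) y /\
    cont2_at f x y /\
    cont2_at (fun s t => dx (dx f) s t) x y /\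
    cont2_at (fun s t => dy (dx f) s t) x y /\
    cont2_at (fun s t => dx (dy f) s t) x y /\
    cont2_at (fun s t => dy (dy f) s t) x y.

Definition pucci_hess (lam Lam : R) (f : R -> R -> R) (x y : R) : R :=
  pucci_plus lam Lam (dx (dx f) x y) (dy (dx f) x y) (dy (dy f) x y).

Definition domain := R -> R -> Prop.

Definition cont_on (A : domain) (u : R -> R -> R) : Prop :=
  forall x0 y0, A x0 y0 -> forall eps, 0 < eps -> exists del, 0 < del /\
    forall x y, A x y -> dist2 x y x0 y0 < del -> Rabs (u x y - u x0 y0) < eps.

Definition closure (O : domain) : domain :=
  fun x0 y0 => forall eps, 0 < eps -> exists x y, O x y /\ dist2 x y x0 y0 < eps.

Definition boundary (O : domain) : domain :=
  fun x y => closure O x y /\ ~ O x y.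

Definition loc_min_diff (O : domain) (u phi : R -> R -> R) (x0 y0 : R) : Prop :=
  exists r, 0 < r /\ forall x y, O x y -> dist2 x y x0 y0 < r ->
    u x0 y0 - phi x0 y0 <= u x y - phi x y.
Definition loc_max_diff (O : domain) (u phi : R -> R -> R) (x0 y0 : R) : Prop :=
  exists r, 0 < r /\ forall x y, O x y -> dist2 x y x0 y0 < r ->
    u x y - phi x y <= u x0 y0 - phi x0 y0.

Definition visc_super (lam Lam mu : R) (O : domain) (u : R -> R -> R) : Prop :=
  cont_on O u /\
  forall phi x0 y0, C2 phi -> O x0 y0 -> loc_min_diff O u phi x0 y0 ->
    pucci_hess lam Lam phi x0 y0 + mu * u x0 y0 <= 0.

Definition visc_sub (lam Lam mu : R) (O : domain) (u : R -> R -> R) : Prop :=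
  cont_on O u /\
  forall phi x0 y0, C2 phi -> O x0 y0 -> loc_max_diff O u phi x0 y0 ->
    pucci_hess lam Lam phi x0 y0 + mu * u x0 y0 >= 0.

Definition visc_sol lam Lam mu O u := visc_super lam Lam mu O u /\ visc_sub lam Lam mu O u.

Definition eig_candidates (lam Lam : R) (O : domain) : R -> Prop :=
  fun mu => exists phi : R -> R -> R,
    (forall x y, O x y -> 0 < phi x y) /\ visc_super lam Lam mu O phi.

Definition principal_eigenvalue (lam Lam : R) (O : domain) (m : R) : Prop :=
  is_lub (eig_candidates lam Lam O) m.

Definition principal_eigenfunction (lam Lam : R) (O : domain) (m : R)
  (u : R -> R -> R) : Prop :=
  (forall x y, O x y -> 0 < u x y) /\
  cont_on (closure O) u /\
  (forall x y, boundary O x y -> u x y = 0) /\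
  visc_sol lam Lam m O u.

Definition phi_half_width (om g : R) : R := PI / 2 + sqrt om * asin (1 / (g * sqrt om)).

Definition phi_og (om g x : R) : R :=
  if Rle_dec (Rabs x) (PI / 2) then PI / 2 + sqrt om * asin (g / sqrt om * cos x)
  else acos (g * sqrt om * sin ((Rabs x - PI / 2) / sqrt om)).

Definition Omega_og (om g : R) : domain :=
  fun x y => Rabs x <= phi_half_width om g /\ Rabs y < phi_og om g x.

Definition u_og (om g x y : R) : R :=
  if Rle_dec (Rabs x) (PI / 2) then
    if Rle_dec (Rabs y) (PI / 2) then g * cos x + cos y
    else g * cos x + sqrt om * cos ((Rabs y - PI / 2) / sqrt om + PI / 2)
  else g * sqrt om * cos ((Rabs x - PI / 2) / sqrt om + PI / 2) + cos y.

(* Main.v *)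
Require Import Defs.
From Stdlib Require Import Reals.
From Coquelicot Require Import Coquelicot.
From Stdlib Require Import Lra Psatz Classical ClassicalEpsilon List.
From Stdlib Require Import FunctionalExtensionality PropExtensionality.
Open Scope R_scope.

(** The profile [F] ([prof] below) with [F x = cos x] for [|x| <= pi/2] and
    [F x = - sqrt om * sin ((|x| - pi/2) / sqrt om)] beyond is globally C^2, and on
    [|x| <= pi/2 + sqrt om * pi/2] it satisfies [F'' = - F] where [F >= 0] and [F'' = - F / om]
    where [F < 0].  Hence [u (x, y) = g * F x + F y] is a classical solution of
    [M+ (D^2 u) + lam * u = 0], the domain is the component of [u > 0] containing the origin,
    and [u] vanishes on its boundary.

    Everything else follows from one fact: a positive viscosity supersolution [v] at level [lam]
    is a multiple of [u].  Let [c] be the largest constant with [c * u <= v].  As [u] is smooth,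
    exponential barriers give a strong minimum principle for [v - c * u], so if [v] is not [c * u]
    then [v > c * u] everywhere, hence [v >= (c + eps) * u] on the compact set [u >= 1/6].  On
    [0 <= u <= 1/6] the function [psi = 1 + (F x)_+^3 + (F y)_+^3 - 9 * u^2] is a strict
    supersolution: [- 9 * u^2] dominates where [grad u <> 0], the cubes at the corners where
    [grad u = 0].  Comparison with [psi] propagates [v >= (c + eps) * u] up to the boundary,
    against the choice of [c].  No behaviour of [v] at the boundary is used, since the extension
    of [v] by [0] is lower semicontinuous. *)

(** * The Pucci operator *)

Lemma pucci_term_max (lam Lam e : R) :
  0 < lam -> lam <= Lam -> pucci_term lam Lam e = Rmax (lam * e) (Lam * e).
Proof.
  intros Hl HL; unfold pucci_term.
  destruct (Rlt_dec e 0) as [He|He].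
  { rewrite Rmax_left; nra. }
  destruct (Rlt_dec 0 e) as [He'|He'].
  { rewrite Rmax_right; nra. }
  replace e with 0 by lra. rewrite Rmax_left; nra.
Qed.

Lemma pucci_term_mono (lam Lam e e' : R) :
  0 < lam -> lam <= Lam -> e <= e' -> pucci_term lam Lam e <= pucci_term lam Lam e'.
Proof.
  intros Hl HL He; rewrite !pucci_term_max by assumption.
  apply Rmax_lub.
  - apply Rle_trans with (lam * e'); [nra | apply Rmax_l].
  - apply Rle_trans with (Lam * e'); [nra | apply Rmax_r].
Qed.

Lemma pucci_term_ge (lam Lam p e : R) :
  0 < lam -> lam <= p <= Lam -> p * e <= pucci_term lam Lam e.
Proof.
  intros Hl Hp; rewrite pucci_term_max by lra.
  destruct (Rle_dec 0 e).
  - apply Rle_trans with (Lam * e); [nra | apply Rmax_r].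
  - apply Rle_trans with (lam * e); [nra | apply Rmax_l].
Qed.

(** [M+] is the supremum of [tr (A X)] over symmetric [A] with spectrum in [[lam, Lam]]; this is the
    case of diagonal [A]. The entry [b] drops out of the bound, so mixed derivatives of test
    functions never matter later. *)
Lemma pucci_ge_diag (lam Lam al be a b c : R) :
  0 < lam -> lam <= al <= Lam -> lam <= be <= Lam ->
  al * a + be * c <= pucci_plus lam Lam a b c.
Proof.
  intros Hl Ha Hb; unfold pucci_plus, eig_lo, eig_hi.
  set (d := (a - c) / 2). set (r := sqrt (d ^ 2 + b ^ 2)).
  assert (Hr0 : 0 <= r) by apply sqrt_pos.
  assert (Hr2 : r * r = d ^ 2 + b ^ 2).
  { apply sqrt_sqrt. pose proof (pow2_ge_0 d); pose proof (pow2_ge_0 b); lra. }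
  assert (Hd : - r <= d <= r) by (split; nra).
  (* [th] is the cosine of twice the angle of the eigenframe. The numbers [q] and [p] below average
     [al] and [be] with weights [(1 + th) / 2] and [(1 - th) / 2], in the two orders, and are the
     weights of the eigenvalues in the diagonal form. *)
  assert (exists th, -1 <= th <= 1 /\ d = th * r) as [th [Hth Hdth]].
  { destruct (Req_dec r 0) as [H0|H0].
    - exists 0; split; lra.
    - exists (d / r). split; [|field; exact H0].
      assert (0 < r) by lra.
      split; [apply Rle_div_r | apply Rle_div_l]; lra. }
  set (q := (al + be + (al - be) * th) / 2). set (p := (al + be - (al - be) * th) / 2).
  assert (Hq : lam <= q <= Lam) by (unfold q; split; nra).
  assert (Hp : lam <= p <= Lam) by (unfold p; split; nra).
  apply Rle_trans with (p * ((a + c) / 2 - r) + q * ((a + c) / 2 + r)).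
  - right. replace a with ((a + c) / 2 + th * r) at 1 by (rewrite <- Hdth; unfold d; field).
    replace c with ((a + c) / 2 - th * r) at 2 by (rewrite <- Hdth; unfold d; field).
    unfold p, q; field.
  - apply Rplus_le_compat; apply pucci_term_ge; assumption.
Qed.

Lemma norm2_triangle (x y u v t : R) :
  0 <= t -> u ^ 2 + v ^ 2 <= t ^ 2 ->
  sqrt ((x + u) ^ 2 + (y + v) ^ 2) <= sqrt (x ^ 2 + y ^ 2) + t.
Proof.
  intros Ht H. set (r := sqrt (x ^ 2 + y ^ 2)).
  assert (Hr0 : 0 <= r) by apply sqrt_pos.
  assert (Hr2 : r * r = x ^ 2 + y ^ 2).
  { apply sqrt_sqrt. pose proof (pow2_ge_0 x); pose proof (pow2_ge_0 y); lra. }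
  assert (Hc : x * u + y * v <= r * t).
  { apply Rsqr_incr_0_var; [|nra]. unfold Rsqr.
    (* Cauchy-Schwarz through Lagrange's identity [(xu + yv)^2 + (xv - yu)^2 = (x^2 + y^2)(u^2 +
       v^2)]. *)
    assert (0 <= (x * v - y * u) ^ 2) by apply pow2_ge_0.
    assert ((x * u + y * v) * (x * u + y * v) <= (r * r) * (u ^ 2 + v ^ 2)) by (rewrite Hr2; nra).
    assert ((r * r) * (u ^ 2 + v ^ 2) <= (r * r) * t ^ 2) by (apply Rmult_le_compat_l; nra).
    nra. }
  rewrite <- (sqrt_square (r + t)) by lra.
  apply sqrt_le_1_alt. nra.
Qed.

(** The hypotheses say that the difference of the two matrices is positive semidefinite. With [t]
    its half trace, the mean of the eigenvalues grows by [t] and, by the triangle inequality, their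
    half gap changes by at most [t]; so neither eigenvalue decreases. *)
Lemma pucci_mono (lam Lam a b c a' b' c' : R) :
  0 < lam -> lam <= Lam -> a <= a' -> c <= c' ->
  (b' - b) ^ 2 <= (a' - a) * (c' - c) ->
  pucci_plus lam Lam a b c <= pucci_plus lam Lam a' b' c'.
Proof.
  intros Hl HL Ha Hc Hb; unfold pucci_plus.
  set (t := ((a' - a) + (c' - c)) / 2).
  assert (Ht : (((a' - a) - (c' - c)) / 2) ^ 2 + (b' - b) ^ 2 <= t ^ 2) by (unfold t; nra).
  assert (0 <= t) by (unfold t; lra).
  assert (sqrt (((a - c) / 2) ^ 2 + b ^ 2) <= sqrt (((a' - c') / 2) ^ 2 + b' ^ 2) + t).
  { replace ((a - c) / 2) with ((a' - c') / 2 + - (((a' - a) - (c' - c)) / 2)) by field.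
    replace b with (b' + - (b' - b)) by ring.
    apply norm2_triangle; [assumption | nra]. }
  assert (sqrt (((a' - c') / 2) ^ 2 + b' ^ 2) <= sqrt (((a - c) / 2) ^ 2 + b ^ 2) + t).
  { replace ((a' - c') / 2) with ((a - c) / 2 + (((a' - a) - (c' - c)) / 2)) by field.
    replace b' with (b + (b' - b)) by ring.
    apply norm2_triangle; [assumption | nra]. }
  apply Rplus_le_compat; apply pucci_term_mono; try assumption;
    unfold eig_lo, eig_hi, t in *; lra.
Qed.

Lemma pucci_diag (lam Lam a c : R) :
  pucci_plus lam Lam a 0 c = pucci_term lam Lam a + pucci_term lam Lam c.
Proof.
  unfold pucci_plus, eig_lo, eig_hi.
  replace (((a - c) / 2) ^ 2 + 0 ^ 2) with (Rsqr ((a - c) / 2)) by (unfold Rsqr; ring).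
  rewrite sqrt_Rsqr_abs.
  destruct (Rle_dec 0 ((a - c) / 2)).
  - rewrite Rabs_pos_eq by assumption. rewrite Rplus_comm; do 2 f_equal; field.
  - rewrite Rabs_left by lra. do 2 f_equal; field.
Qed.

(** * Second-order condition at a local minimum *)

Lemma dist2_lt_of_box (x y x0 y0 r : R) :
  Rabs (x - x0) < r / 2 -> Rabs (y - y0) < r / 2 -> dist2 x y x0 y0 < r.
Proof.
  intros Hx Hy. assert (0 < r) by (pose proof (Rabs_pos (x - x0)); lra).
  apply Rabs_def2 in Hx; apply Rabs_def2 in Hy.
  unfold dist2. rewrite <- (sqrt_pow2 r) by lra.
  assert ((x - x0) ^ 2 < (r / 2) ^ 2) by nra. assert ((y - y0) ^ 2 < (r / 2) ^ 2) by nra.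
  pose proof (pow2_ge_0 (x - x0)); pose proof (pow2_ge_0 (y - y0)).
  apply sqrt_lt_1_alt. split; nra.
Qed.

Lemma box_lt_of_dist2 (x y x0 y0 r : R) :
  dist2 x y x0 y0 < r -> Rabs (x - x0) < r /\ Rabs (y - y0) < r.
Proof.
  intros H; unfold dist2 in H.
  pose proof (pow2_ge_0 (x - x0)); pose proof (pow2_ge_0 (y - y0)).
  split; (eapply Rle_lt_trans; [|exact H]);
    rewrite <- sqrt_Rsqr_abs; apply sqrt_le_1_alt; unfold Rsqr; lra.
Qed.

Lemma cont2_at_2d (g : R -> R -> R) (x y : R) : cont2_at g x y <-> continuity_2d_pt g x y.
Proof.
  split.
  - intros H eps. destruct (H eps (cond_pos eps)) as [d [Hd Hc]].
    exists (mkposreal _ (is_pos_div_2 (mkposreal d Hd))); simpl; intros u v Hu Hv.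
    apply Hc, dist2_lt_of_box; assumption.
  - intros H eps He. destruct (H (mkposreal eps He)) as [d Hd].
    exists d; split; [apply cond_pos|]. intros u v Huv.
    apply box_lt_of_dist2 in Huv. apply Hd; tauto.
Qed.

(** If [l < 0] then [g1], which vanishes at 0, is negative just to the right of 0, and by the mean
    value theorem [g] drops below [g 0] there. *)
Lemma is_derive_min_second (g g1 : R -> R) (l r : R) :
  (forall t, is_derive g t (g1 t)) -> is_derive g1 0 l ->
  0 < r -> (forall t, Rabs t < r -> g 0 <= g t) -> 0 <= l.
Proof.
  intros Hg Hg1 Hr Hmin.
  assert (H0 : g1 0 = 0).
  { assert (pr : derivable_pt g 0) by (exists (g1 0); apply is_derive_Reals, Hg).
    assert (E : derive_pt g 0 pr = 0).
    { apply deriv_minimum with (- r) r; try lra.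
      intros x H1 H2; apply Hmin, Rabs_def1; lra. }
    assert (E2 : derive_pt g 0 pr = g1 0) by (apply derive_pt_eq_0, is_derive_Reals, Hg).
    lra. }
  destruct (Rle_dec 0 l) as [|Hl]; [assumption|exfalso].
  apply is_derive_Reals in Hg1.
  destruct (Hg1 (- l / 2)) as [d Hd]; [lra|].
  set (t := Rmin d r / 2).
  assert (Ht : 0 < t < d /\ t < r).
  { pose proof (cond_pos d). unfold t, Rmin; destruct (Rle_dec d r); lra. }
  destruct (MVT_cor2 g g1 0 t) as [c [E Hc]]; [lra | intros; apply is_derive_Reals, Hg |].
  assert (Hgt : g 0 <= g t) by (apply Hmin; rewrite Rabs_pos_eq; lra).
  assert (Hd' : Rabs ((g1 (0 + c) - g1 0) / c - l) < - l / 2).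
  { apply Hd; [lra | rewrite Rabs_pos_eq; lra]. }
  rewrite Rplus_0_l, H0 in Hd'. apply Rabs_def2 in Hd'.
  assert (g1 c < 0).
  { assert ((g1 c - 0) / c < 0) by lra.
    replace (g1 c) with ((g1 c - 0) / c * c) by (field; lra). nra. }
  nra.
Qed.

Lemma differentiable_of_partials (f : R -> R -> R) (x y : R) :
  (forall u v, ex_derive (fun t => f t v) u) -> ex_derive (fun t => f x t) y ->
  continuity_2d_pt (dx f) x y ->
  differentiable_pt_lim f x y (dx f x y) (dy f x y).
Proof.
  intros Hx Hy Hc. apply filterdiff_differentiable_pt_lim.
  apply (is_derive_filterdiff f x y (dx f) (dy f x y)).
  - apply filter_forall; intros [u v]; simpl. apply Derive_correct, Hx.
  - apply Derive_correct, Hy.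
  - apply continuity_2d_pt_filterlim, Hc.
Qed.

Lemma is_derive_along (f : R -> R -> R) (x y p q t lx ly : R) :
  differentiable_pt_lim f (x + t * p) (y + t * q) lx ly ->
  is_derive (fun s => f (x + s * p) (y + s * q)) t (lx * p + ly * q).
Proof.
  intros H. apply is_derive_Reals.
  apply (derivable_pt_lim_comp_2d f (fun s => x + s * p) (fun s => y + s * q)); [exact H | |];
    apply is_derive_Reals; auto_derive; trivial; ring.
Qed.

(** Restriction to a line reduces the second-order condition to one variable. The mixed partials
    agree by Schwarz's theorem, so the second derivative is the Hessian form at [(p, q)]. *)
Lemma C2_along (f : R -> R -> R) (x y p q : R) :
  C2 f ->
  (forall t, is_derive (fun s => f (x + s * p) (y + s * q)) t
     (dx f (x + t * p) (y + t * q) * p + dy f (x + t * p) (y + t * q) * q)) /\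
  is_derive (fun t => dx f (x + t * p) (y + t * q) * p + dy f (x + t * p) (y + t * q) * q) 0
    (dx (dx f) x y * p ^ 2 + 2 * dy (dx f) x y * p * q + dy (dy f) x y * q ^ 2).
Proof.
  intros H.
  assert (Dx : forall u v, differentiable_pt_lim (dx f) u v (dx (dx f) u v) (dy (dx f) u v)).
  { intros u v. apply differentiable_of_partials.
    - intros a b; apply (H a b).
    - apply (H u v).
    - apply cont2_at_2d, (H u v). }
  assert (Dy : forall u v, differentiable_pt_lim (dy f) u v (dx (dy f) u v) (dy (dy f) u v)).
  { intros u v. apply differentiable_of_partials.
    - intros a b; apply (H a b).
    - apply (H u v).
    - apply cont2_at_2d, (H u v). }
  assert (D : forall u v, differentiable_pt_lim f u v (dx f u v) (dy f u v)).
  { intros u v. apply differentiable_of_partials.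
    - intros a b; apply (H a b).
    - apply (H u v).
    (* [C2] does not list continuity of the first partials; it comes from the differentiability of
       [dx f] just proved. *)
    - apply differentiable_continuity_pt. eexists; eexists; apply Dx. }
  assert (S : dx (dy f) x y = dy (dx f) x y).
  { apply (Schwarz f x y).
    - exists (mkposreal 1 Rlt_0_1); intros u v _ _. destruct (H u v) as (?&?&?&?&?&_).
      repeat split; assumption.
    - apply cont2_at_2d, (H x y).
    - apply cont2_at_2d, (H x y). }
  split.
  - intros t. apply is_derive_along, D.
  - replace (dx (dx f) x y * p ^ 2 + 2 * dy (dx f) x y * p * q + dy (dy f) x y * q ^ 2)
      with (plus (scal p (dx (dx f) x y * p + dy (dx f) x y * q))
                 (scal q (dx (dy f) x y * p + dy (dy f) x y * q))).
    2: { rewrite S. unfold plus, scal; simpl; unfold mult; simpl; ring. }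
    apply (is_derive_ext (fun t => plus (scal p (dx f (x + t * p) (y + t * q)))
                                   (scal q (dy f (x + t * p) (y + t * q))))).
    { intros t. unfold plus, scal; simpl; unfold mult; simpl; ring. }
    apply (is_derive_plus (K := R_AbsRing) (V := R_NormedModule)); apply is_derive_scal;
      apply is_derive_along; rewrite !Rmult_0_l, !Rplus_0_r; [apply Dx | apply Dy].
Qed.

(** [f - g] has a local minimum, so its Hessian form is non-negative in every direction, and
    [pucci_mono] compares the two Hessians. *)
Lemma pucci_hess_le_of_min (lam Lam : R) (f g : R -> R -> R) (x y : R) :
  0 < lam -> lam <= Lam -> C2 f -> C2 g ->
  locally_2d (fun u v => f x y - g x y <= f u v - g u v) x y ->
  pucci_hess lam Lam g x y <= pucci_hess lam Lam f x y.
Proof.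
  intros Hl HL Hf Hg [r Hr].
  assert (Q : forall p q, 0 <= (dx (dx f) x y - dx (dx g) x y) * p ^ 2
     + 2 * (dy (dx f) x y - dy (dx g) x y) * p * q + (dy (dy f) x y - dy (dy g) x y) * q ^ 2).
  { intros p q.
    destruct (C2_along f x y p q Hf) as [F1 F2].
    destruct (C2_along g x y p q Hg) as [G1 G2].
    assert (Hn : 0 < 1 + Rabs p + Rabs q).
    { pose proof (Rabs_pos p); pose proof (Rabs_pos q); lra. }
    replace (_ + _) with (minus
      (dx (dx f) x y * p ^ 2 + 2 * dy (dx f) x y * p * q + dy (dy f) x y * q ^ 2)
      (dx (dx g) x y * p ^ 2 + 2 * dy (dx g) x y * p * q + dy (dy g) x y * q ^ 2))
      by (unfold minus, plus, opp; simpl; ring).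
    eapply (is_derive_min_second
       (fun s => minus (f (x + s * p) (y + s * q)) (g (x + s * p) (y + s * q)))
       _ _ (r / (1 + Rabs p + Rabs q))).
    - intros t. apply (is_derive_minus (K := R_AbsRing) (V := R_NormedModule)); [apply F1 | apply G1].
    - apply (is_derive_minus (K := R_AbsRing) (V := R_NormedModule)); [exact F2 | exact G2].
    - apply Rdiv_lt_0_compat; [apply cond_pos | exact Hn].
    - intros t Ht. rewrite !Rmult_0_l, !Rplus_0_r.
      apply Rlt_div_r in Ht; [|exact Hn].
      pose proof (Rabs_pos p); pose proof (Rabs_pos q); pose proof (Rabs_pos t).
      apply Hr; rewrite Rplus_comm; unfold Rminus; rewrite Rplus_assoc, Rplus_opp_r, Rplus_0_r,
        Rabs_mult; nra. }
  set (a := dx (dx f) x y - dx (dx g) x y) in *. set (b := dy (dx f) x y - dy (dx g) x y) in *.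
  set (c := dy (dy f) x y - dy (dy g) x y) in *.
  assert (Ha : 0 <= a) by (specialize (Q 1 0); lra).
  assert (Hc : 0 <= c) by (specialize (Q 0 1); lra).
  apply pucci_mono; try assumption; fold a b c; try (unfold a, c in *; lra).
  (* The determinant is read off from single directions: [(- b, a)] gives
     [a * (a * c - b ^ 2) >= 0], and when [a = 0] the direction [(- (c + 1), b)] forces [b = 0]. *)
  destruct (Req_dec a 0) as [Ha0|Ha0].
  - pose proof (Q (- b * (c + 1)) (b ^ 2)) as Q1. rewrite Ha0 in *.
    specialize (Q (- (c + 1)) b).
    assert (b ^ 2 * (c + 2) <= 0) by nra. nra.
  - specialize (Q (- b) a). assert (0 <= a * (a * c - b ^ 2)) by nra.
    assert (0 <= a * c - b ^ 2) by (apply Rmult_le_reg_l with a; nra). lra.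
Qed.

(** * C^2 functions of one variable and separable test functions *)

(** The derivatives are explicit functions rather than [Derive] terms, so that the closure lemmas
    compute the Hessians of compound test functions. *)
Definition C2fun (f f1 f2 : R -> R) : Prop :=
  forall x, is_derive f x (f1 x) /\ is_derive f1 x (f2 x) /\ continuity_pt f2 x.

Lemma is_derive_continuity_pt (f : R -> R) (x l : R) : is_derive f x l -> continuity_pt f x.
Proof.
  intros H. apply derivable_continuous_pt. exists l. apply is_derive_Reals, H.
Qed.

Lemma C2fun_ext (f f1 f2 g g1 g2 : R -> R) :
  C2fun f f1 f2 -> (forall x, f x = g x) -> (forall x, f1 x = g1 x) -> (forall x, f2 x = g2 x) ->
  C2fun g g1 g2.
Proof.
  intros H E E1 E2.
  apply functional_extensionality in E, E1, E2. subst; exact H.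
Qed.

Lemma C2fun_const (c : R) : C2fun (fun _ => c) (fun _ => 0) (fun _ => 0).
Proof.
  intros x; split; [|split]; try (auto_derive; trivial).
  apply (is_derive_continuity_pt (fun _ => 0) x 0); auto_derive; trivial.
Qed.

Lemma C2fun_plus (f f1 f2 g g1 g2 : R -> R) :
  C2fun f f1 f2 -> C2fun g g1 g2 ->
  C2fun (fun x => f x + g x) (fun x => f1 x + g1 x) (fun x => f2 x + g2 x).
Proof.
  intros Hf Hg x; destruct (Hf x) as (?&?&?), (Hg x) as (?&?&?).
  split; [|split]; try (apply (is_derive_plus (K := R_AbsRing) (V := R_NormedModule)); assumption).
  apply (continuity_pt_plus f2 g2); assumption.
Qed.

Lemma C2fun_mult (f f1 f2 g g1 g2 : R -> R) :
  C2fun f f1 f2 -> C2fun g g1 g2 ->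
  C2fun (fun x => f x * g x) (fun x => f1 x * g x + f x * g1 x)
        (fun x => f2 x * g x + 2 * f1 x * g1 x + f x * g2 x).
Proof.
  intros Hf Hg.
  assert (M : forall u u1 v v1 x, is_derive u x u1 -> is_derive v x v1 ->
    is_derive (fun t => u t * v t) x (u1 * v x + u x * v1)).
  { intros u u1 v v1 x Hu Hv. apply is_derive_Reals. apply (derivable_pt_lim_mult u v);
      apply is_derive_Reals; assumption. }
  intros x; destruct (Hf x) as (F0&F1&F2), (Hg x) as (G0&G1&G2). split; [|split].
  - apply M; assumption.
  - replace (f2 x * g x + 2 * f1 x * g1 x + f x * g2 x) with
      ((f2 x * g x + f1 x * g1 x) + (f1 x * g1 x + f x * g2 x)) by ring.
    apply (is_derive_plus (K := R_AbsRing) (V := R_NormedModule)); apply M; assumption.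
  - assert (continuity_pt f x) by (eapply is_derive_continuity_pt; eassumption).
    assert (continuity_pt f1 x) by (eapply is_derive_continuity_pt; eassumption).
    assert (continuity_pt g x) by (eapply is_derive_continuity_pt; eassumption).
    assert (continuity_pt g1 x) by (eapply is_derive_continuity_pt; eassumption).
    apply (continuity_pt_plus (fun x => f2 x * g x + 2 * f1 x * g1 x) (fun x => f x * g2 x)).
    + apply (continuity_pt_plus (fun x => f2 x * g x) (fun x => 2 * f1 x * g1 x)).
      * apply (continuity_pt_mult f2 g); assumption.
      * apply (continuity_pt_mult (fun x => 2 * f1 x) g1); [|assumption].
        apply (continuity_pt_scal f1 2); assumption.
    + apply (continuity_pt_mult f g2); assumption.
Qed.

Lemma C2fun_scal (c : R) (f f1 f2 : R -> R) :
  C2fun f f1 f2 -> C2fun (fun x => c * f x) (fun x => c * f1 x) (fun x => c * f2 x).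
Proof.
  intros H. eapply C2fun_ext; [exact (C2fun_mult _ _ _ _ _ _ (C2fun_const c) H) | ..];
    intros x; simpl; ring.
Qed.

Lemma C2fun_comp (f f1 f2 g g1 g2 : R -> R) :
  C2fun f f1 f2 -> C2fun g g1 g2 ->
  C2fun (fun x => g (f x)) (fun x => g1 (f x) * f1 x)
        (fun x => g2 (f x) * f1 x ^ 2 + g1 (f x) * f2 x).
Proof.
  intros Hf Hg.
  assert (M : forall u u1 x, is_derive u (f x) u1 -> is_derive (fun t => u (f t)) x (u1 * f1 x)).
  { intros u u1 x Hu. apply is_derive_Reals.
    apply (derivable_pt_lim_comp f u); apply is_derive_Reals; [apply Hf | exact Hu]. }
  intros x; destruct (Hf x) as (F0&F1&F2), (Hg (f x)) as (G0&G1&G2). split; [|split].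
  - apply M; assumption.
  - replace (g2 (f x) * f1 x ^ 2 + g1 (f x) * f2 x) with
      ((g2 (f x) * f1 x) * f1 x + g1 (f x) * f2 x) by ring.
    apply is_derive_Reals.
    apply (derivable_pt_lim_mult (fun t => g1 (f t)) f1); apply is_derive_Reals; [|assumption].
    apply M; assumption.
  - assert (continuity_pt f x) by (eapply is_derive_continuity_pt; eassumption).
    assert (continuity_pt f1 x) by (eapply is_derive_continuity_pt; eassumption).
    assert (continuity_pt g1 (f x)) by (eapply is_derive_continuity_pt; eassumption).
    apply (continuity_pt_plus (fun x => g2 (f x) * f1 x ^ 2) (fun x => g1 (f x) * f2 x)).
    + apply (continuity_pt_mult (fun x => g2 (f x)) (fun x => f1 x ^ 2)).
      * apply (continuity_pt_comp f g2); assumption.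
      * apply (continuity_pt_comp f1 (fun t => t ^ 2)); [assumption|].
        eapply is_derive_continuity_pt; auto_derive; trivial.
    + apply (continuity_pt_mult (fun x => g1 (f x)) f2); [|assumption].
      apply (continuity_pt_comp f g1); assumption.
Qed.

(** * Gluing two C^2 functions at a point *)

Definition glue (a : R) (g h : R -> R) (x : R) : R := if Rle_dec x a then g x else h x.

Lemma glue_left (a : R) (g h : R -> R) (x : R) : x <= a -> glue a g h x = g x.
Proof. intros H; unfold glue; destruct (Rle_dec x a); [reflexivity | lra]. Qed.

Lemma glue_right (a : R) (g h : R -> R) (x : R) : g a = h a -> a <= x -> glue a g h x = h x.
Proof.
  intros E H; unfold glue; destruct (Rle_dec x a); [|reflexivity].
  replace x with a by lra; exact E.
Qed.

Lemma glue_locally (a : R) (g h : R -> R) (x : R) :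
  g a = h a ->
  (x < a /\ locally x (fun t => g t = glue a g h t)) \/
  (a < x /\ locally x (fun t => h t = glue a g h t)) \/ x = a.
Proof.
  intros E. destruct (Rtotal_order x a) as [H|[H|H]]; [left|tauto|right; left]; split; try lra.
  - assert (Hd : 0 < a - x) by lra. exists (mkposreal _ Hd); intros t Ht.
    apply Rabs_def2 in Ht; simpl in Ht. unfold minus, plus, opp in Ht; simpl in Ht.
    rewrite glue_left; [reflexivity | lra].
  - assert (Hd : 0 < x - a) by lra. exists (mkposreal _ Hd); intros t Ht.
    apply Rabs_def2 in Ht; simpl in Ht. unfold minus, plus, opp in Ht; simpl in Ht.
    rewrite glue_right; [reflexivity | assumption | lra].
Qed.

Lemma is_derive_glue (a : R) (g h g1 h1 : R -> R) (x : R) :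
  g a = h a -> g1 a = h1 a -> is_derive g x (g1 x) -> is_derive h x (h1 x) ->
  is_derive (glue a g h) x (glue a g1 h1 x).
Proof.
  intros E E1 Hg Hh. destruct (glue_locally a g h x E) as [[Hx L]|[[Hx L]|Hx]].
  - rewrite glue_left by lra. exact (is_derive_ext_loc _ _ _ _ L Hg).
  - rewrite glue_right by (assumption || lra). exact (is_derive_ext_loc _ _ _ _ L Hh).
  (* At the junction each one-sided difference quotient is that of [g] or of [h], and the two limits
     agree by [E1]. *)
  - subst x. rewrite glue_left by lra. apply is_derive_Reals.
    apply is_derive_Reals in Hg; apply is_derive_Reals in Hh. rewrite <- E1 in Hh.
    intros eps He. destruct (Hg eps He) as [d1 D1], (Hh eps He) as [d2 D2].
    exists (mkposreal _ (Rmin_stable_in_posreal d1 d2)); simpl; intros k Hk Hkd.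
    assert (Rabs k < d1) by (eapply Rlt_le_trans; [exact Hkd | apply Rmin_l]).
    assert (Rabs k < d2) by (eapply Rlt_le_trans; [exact Hkd | apply Rmin_r]).
    rewrite (glue_left a g h a) by lra.
    destruct (Rle_dec k 0).
    + rewrite glue_left by lra. apply D1; assumption.
    + rewrite glue_right by (assumption || lra). rewrite E. apply D2; assumption.
Qed.

Lemma continuity_pt_glue (a : R) (g h : R -> R) (x : R) :
  g a = h a -> continuity_pt g x -> continuity_pt h x -> continuity_pt (glue a g h) x.
Proof.
  intros E Hg Hh. destruct (glue_locally a g h x E) as [[Hx L]|[[Hx L]|Hx]].
  - exact (continuity_pt_ext_loc _ _ _ L Hg).
  - exact (continuity_pt_ext_loc _ _ _ L Hh).
  - subst x. intros eps He. destruct (Hg eps He) as [d1 [P1 D1]], (Hh eps He) as [d2 [P2 D2]].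
    exists (Rmin d1 d2). split; [apply Rmin_glb_lt; assumption|].
    intros y [Hy Hd]. rewrite (glue_left a g h a) by lra.
    assert (R_met.(dist) y a < d1) by (eapply Rlt_le_trans; [exact Hd | apply Rmin_l]).
    assert (R_met.(dist) y a < d2) by (eapply Rlt_le_trans; [exact Hd | apply Rmin_r]).
    destruct (Rle_dec y a).
    + rewrite glue_left by lra. apply D1; tauto.
    + rewrite glue_right by (assumption || lra). rewrite E. apply D2; tauto.
Qed.

Lemma C2fun_glue (a : R) (g g1 g2 h h1 h2 : R -> R) :
  C2fun g g1 g2 -> C2fun h h1 h2 -> g a = h a -> g1 a = h1 a -> g2 a = h2 a ->
  C2fun (glue a g h) (glue a g1 h1) (glue a g2 h2).
Proof.
  intros Hg Hh E E1 E2 x. destruct (Hg x) as (?&?&?), (Hh x) as (?&?&?).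
  split; [|split]; [apply is_derive_glue | apply is_derive_glue | apply continuity_pt_glue]; assumption.
Qed.

(** Every test function used on a supersolution has this shape: [usum] is of the form [A + B], a
    Gaussian barrier is a product [C * D], and so is the cross term of [usum ^ 2]. *)
Definition sepf (A B C D : R -> R) (x y : R) : R := A x + B y + C x * D y.

Lemma is_derive_sepf_x (A A1 B C C1 D : R -> R) (x y : R) :
  is_derive A x (A1 x) -> is_derive C x (C1 x) ->
  is_derive (fun t => sepf A B C D t y) x (sepf A1 (fun _ => 0) C1 D x y).
Proof.
  intros HA HC. unfold sepf.
  apply (is_derive_plus (K := R_AbsRing) (V := R_NormedModule)).
  - apply (is_derive_plus (K := R_AbsRing) (V := R_NormedModule)); [exact HA|].
    auto_derive; trivial.
  - apply is_derive_Reals. apply is_derive_Reals in HC.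
    replace (C1 x * D y) with (C1 x * D y + C x * 0) by ring.
    apply (derivable_pt_lim_mult C (fun _ => D y)); [exact HC | apply derivable_pt_lim_const].
Qed.

Lemma is_derive_sepf_y (A B B1 C D D1 : R -> R) (x y : R) :
  is_derive B y (B1 y) -> is_derive D y (D1 y) ->
  is_derive (fun t => sepf A B C D x t) y (sepf (fun _ => 0) B1 C D1 x y).
Proof.
  intros HB HD. apply is_derive_ext with (fun t => sepf B A D C t x).
  { intros t; change (sepf B A D C t x = sepf A B C D x t); unfold sepf; ring. }
  replace (sepf (fun _ => 0) B1 C D1 x y) with (sepf B1 (fun _ => 0) D1 C y x)
    by (unfold sepf; ring).
  apply is_derive_sepf_x; assumption.
Qed.

Lemma continuity_sepf (A B C D : R -> R) (x y : R) :
  continuity_pt A x -> continuity_pt B y -> continuity_pt C x -> continuity_pt D y ->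
  continuity_2d_pt (sepf A B C D) x y.
Proof.
  intros HA HB HC HD.
  apply continuity_2d_pt_plus; [apply continuity_2d_pt_plus | apply continuity_2d_pt_mult];
    apply (continuity_1d_2d_pt_comp _ (fun u v => u))
    || apply (continuity_1d_2d_pt_comp _ (fun u v => v)); try assumption;
    apply continuity_2d_pt_id1 || apply continuity_2d_pt_id2.
Qed.

(** Each partial derivative of a [sepf] is again a [sepf]. Stated as equalities of functions, these
    facts let iterated derivatives be computed by rewriting. *)
Lemma C2_sepf (A A1 A2 B B1 B2 C C1 C2 D D1 D2 : R -> R) :
  C2fun A A1 A2 -> C2fun B B1 B2 -> C2fun C C1 C2 -> C2fun D D1 D2 ->
  Defs.C2 (sepf A B C D) /\
  forall lam Lam x y, pucci_hess lam Lam (sepf A B C D) x y =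
    pucci_plus lam Lam (A2 x + C2 x * D y) (C1 x * D1 y) (B2 y + C x * D2 y).
Proof.
  intros HA HB HC HD.
  assert (DR : forall f f1 f2 : R -> R, C2fun f f1 f2 ->
    (forall x, is_derive f x (f1 x)) /\ (forall x, is_derive f1 x (f2 x)) /\
    (forall x, continuity_pt f x) /\ (forall x, continuity_pt f1 x) /\ (forall x, continuity_pt f2 x)).
  { intros f f1 f2 H. refine (conj _ (conj _ (conj _ (conj _ _)))); intros x;
      destruct (H x) as (H0&H1&H2); try assumption.
    - exact (is_derive_continuity_pt _ _ _ H0).
    - exact (is_derive_continuity_pt _ _ _ H1). }
  destruct (DR _ _ _ (C2fun_const 0)) as (HO&_&KO&_).
  destruct (DR _ _ _ HA) as (a0&a1&ka0&ka1&ka2), (DR _ _ _ HB) as (b0&b1&kb0&kb1&kb2).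
  destruct (DR _ _ _ HC) as (c0&c1&kc0&kc1&kc2), (DR _ _ _ HD) as (d0&d1&kd0&kd1&kd2).
  assert (Ex : forall f f1 g h h1 k : R -> R,
    (forall x, is_derive f x (f1 x)) -> (forall x, is_derive h x (h1 x)) ->
    dx (sepf f g h k) = sepf f1 (fun _ => 0) h1 k /\
    forall x y, ex_derive (fun t => sepf f g h k t y) x).
  { intros f f1 g h h1 k Hf Hh.
    assert (E : forall x y, is_derive (fun t => sepf f g h k t y) x (sepf f1 (fun _ => 0) h1 k x y)).
    { intros x y; apply is_derive_sepf_x; auto. }
    split.
    - apply functional_extensionality; intros x; apply functional_extensionality; intros y.
      apply is_derive_unique, E.
    - intros x y; eexists; apply E. }
  assert (Ey : forall f g g1 h k k1 : R -> R,
    (forall x, is_derive g x (g1 x)) -> (forall x, is_derive k x (k1 x)) ->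
    dy (sepf f g h k) = sepf (fun _ => 0) g1 h k1 /\
    forall x y, ex_derive (fun t => sepf f g h k x t) y).
  { intros f g g1 h k k1 Hg Hk.
    assert (E : forall x y, is_derive (fun t => sepf f g h k x t) y (sepf (fun _ => 0) g1 h k1 x y)).
    { intros x y; apply is_derive_sepf_y; auto. }
    split.
    - apply functional_extensionality; intros x; apply functional_extensionality; intros y.
      apply is_derive_unique, E.
    - intros x y; eexists; apply E. }
  destruct (Ex A A1 B C C1 D a0 c0) as [Fx Gx].
  destruct (Ey A B B1 C D D1 b0 d0) as [Fy Gy].
  destruct (Ex A1 A2 (fun _ => 0) C1 C2 D a1 c1) as [Fxx Gxx].
  destruct (Ey A1 (fun _ => 0) (fun _ => 0) C1 D D1 HO d0) as [Fxy Gxy].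
  destruct (Ex (fun _ => 0) (fun _ => 0) B1 C C1 D1 HO c0) as [Fyx Gyx].
  destruct (Ey (fun _ => 0) B1 B2 C D1 D2 b1 d1) as [Fyy Gyy].
  split.
  - intros x y. rewrite Fx, Fy, Fxx, Fxy, Fyx, Fyy.
    refine (conj (Gx x y) (conj (Gy x y) (conj (Gxx x y) (conj (Gxy x y) (conj (Gyx x y)
      (conj (Gyy x y) (conj _ (conj _ (conj _ (conj _ _))))))))));
      apply cont2_at_2d, continuity_sepf; auto.
  - intros lam Lam x y. unfold pucci_hess. rewrite Fx, Fy, Fxx, Fxy, Fyy. unfold sepf.
    f_equal; ring.
Qed.

(** * Minima of lower semicontinuous functions *)

Lemma list_min {T : Type} (f : T -> R) (l : list T) (t0 : T) :
  In t0 l -> exists t, In t l /\ forall s, In s l -> f t <= f s.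
Proof.
  revert t0; induction l as [|a [|b l] IH]; intros t0 H; [contradiction | |].
  - exists a; split; [left; reflexivity|]. intros s [<-|[]]; lra.
  - destruct (IH b (or_introl eq_refl)) as [t [Ht Hm]].
    destruct (Rle_dec (f a) (f t)) as [Ha|Ha].
    + exists a; split; [left; reflexivity|]. intros s [<-|Hs]; [lra|].
      specialize (Hm s Hs); lra.
    + exists t; split; [right; exact Ht|]. intros s [<-|Hs]; [lra | exact (Hm s Hs)].
Qed.

Definition lsc_on (K : R -> R -> Prop) (f : R -> R -> R) : Prop :=
  forall x y, K x y -> forall m, m < f x y -> locally_2d (fun u v => K u v -> m < f u v) x y.

(** Without a minimum, each point of [K] is beaten by another one, which by lower semicontinuity
    beats a whole neighbourhood. Finitely many neighbourhoods cover the square; the best of their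
    witnesses lies in [K] and is itself beaten by one of them, a contradiction. *)
Lemma lsc_attains_min (K : R -> R -> Prop) (f : R -> R -> R) (M x1 y1 : R) :
  K x1 y1 -> (forall x y, K x y -> Rabs x <= M /\ Rabs y <= M) ->
  (forall x y, ~ K x y -> locally_2d (fun u v => ~ K u v) x y) ->
  lsc_on K f ->
  exists x0 y0, K x0 y0 /\ forall x y, K x y -> f x0 y0 <= f x y.
Proof.
  intros H1 HM Hc Hf. apply NNPP; intros Hno.
  assert (W : forall t : R * (R * unit), exists p : posreal * (R * R),
    K (fst (snd p)) (snd (snd p)) /\
    forall u v, Rabs (u - fst t) < fst p -> Rabs (v - fst (snd t)) < fst p -> K u v ->
      f (fst (snd p)) (snd (snd p)) < f u v).
  { intros [x [y []]]; simpl. destruct (classic (K x y)) as [Hk|Hk].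
    - assert (exists a b, K a b /\ f a b < f x y) as [a [b [Hab Hlt]]].
      { apply NNPP; intros Hn; apply Hno. exists x, y; split; [exact Hk|].
        intros u v Huv. apply Rnot_lt_le; intros Hl. apply Hn; exists u, v; tauto. }
      destruct (Hf x y Hk _ Hlt) as [d Hd]. exists (d, (a, b)); simpl; auto.
    (* Off [K] a small neighbourhood misses [K], so the claim is vacuous and [(x1, y1)] is a
       placeholder witness. *)
    - destruct (Hc x y Hk) as [d Hd]. exists (d, (x1, y1)); simpl; split; [exact H1|].
      intros u v Hu Hv Huv; destruct (Hd u v Hu Hv Huv). }
  apply choice in W; destruct W as [w Hw].
  apply (compactness_list 2 (- M, (- M, tt)) (M, (M, tt)) (fun t => fst (w t))).
  intros [l Hl].
  assert (Cov : forall x y, K x y -> exists t, In t l /\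
     f (fst (snd (w t))) (snd (snd (w t))) < f x y).
  { intros x y Hk. destruct (HM x y Hk) as [Bx By].
    apply Rabs_le_between in Bx, By.
    destruct (Hl (x, (y, tt))) as [[a [b []]] [Hin [_ Hclose]]].
    { simpl; tauto. }
    simpl in Hclose. exists (a, (b, tt)); split; [exact Hin|].
    apply (Hw (a, (b, tt))); simpl; tauto. }
  destruct (Cov x1 y1 H1) as [t0 [Ht0 _]].
  destruct (list_min (fun t => f (fst (snd (w t))) (snd (snd (w t)))) l t0 Ht0) as [t [Ht Hmin]].
  destruct (Cov _ _ (proj1 (Hw t))) as [s [Hs Hlt]].
  specialize (Hmin s Hs); simpl in Hmin; lra.
Qed.

(** * The profile *)

(** The profile in the variable [PI / 2 - |x|], with [s] standing for [sqrt om]. Both arcs have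
    value 0, slope 1 and second derivative 0 at the junction, hence the glued function is C^2. *)
Definition prof_arc (s : R) : R -> R := glue 0 (fun t => s * sin (t / s)) sin.
Definition prof_arc1 (s : R) : R -> R := glue 0 (fun t => cos (t / s)) cos.
Definition prof_arc2 (s : R) : R -> R := glue 0 (fun t => - sin (t / s) / s) (fun t => - sin t).

Lemma C2fun_sin : C2fun sin cos (fun t => - sin t).
Proof.
  intros x; split; [|split].
  - auto_derive; trivial; ring.
  - auto_derive; trivial; ring.
  - apply (is_derive_continuity_pt (fun t => - sin t) x (- cos x)). auto_derive; trivial; ring.
Qed.

Lemma C2fun_affine (a b : R) : C2fun (fun t => a + b * t) (fun _ => b) (fun _ => 0).
Proof.
  intros x; split; [|split].
  - auto_derive; trivial; ring.
  - auto_derive; trivial; ring.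
  - apply (is_derive_continuity_pt (fun _ => 0) x 0). auto_derive; trivial; ring.
Qed.

Lemma C2fun_prof_arc (s : R) : s <> 0 -> C2fun (prof_arc s) (prof_arc1 s) (prof_arc2 s).
Proof.
  intros Hs. apply C2fun_glue.
  - eapply C2fun_ext;
      [exact (C2fun_scal s _ _ _ (C2fun_comp _ _ _ _ _ _ (C2fun_affine 0 (/ s)) C2fun_sin)) | ..];
      intros x; simpl; (replace (0 + / s * x) with (x / s) by (field; exact Hs)); field; exact Hs.
  - exact C2fun_sin.
  - unfold Rdiv; rewrite Rmult_0_l, sin_0; ring.
  - unfold Rdiv; rewrite Rmult_0_l; reflexivity.
  - unfold Rdiv; rewrite Rmult_0_l, sin_0; ring.
Qed.

Definition prof (s : R) : R -> R :=
  glue 0 (fun x => prof_arc s (PI / 2 + x)) (fun x => prof_arc s (PI / 2 - x)).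
Definition prof1 (s : R) : R -> R :=
  glue 0 (fun x => prof_arc1 s (PI / 2 + x)) (fun x => - prof_arc1 s (PI / 2 - x)).
Definition prof2 (s : R) : R -> R :=
  glue 0 (fun x => prof_arc2 s (PI / 2 + x)) (fun x => prof_arc2 s (PI / 2 - x)).

(** The even reflection is smooth at 0 because the slope there is [cos (PI / 2) = 0]. *)
Lemma C2fun_prof (s : R) : s <> 0 -> C2fun (prof s) (prof1 s) (prof2 s).
Proof.
  intros Hs. pose proof PI_RGT_0. apply C2fun_glue.
  - eapply C2fun_ext;
      [exact (C2fun_comp _ _ _ _ _ _ (C2fun_affine (PI / 2) 1) (C2fun_prof_arc s Hs)) | ..];
      intros x; simpl; (replace (PI / 2 + 1 * x) with (PI / 2 + x) by ring); ring.
  - eapply C2fun_ext;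
      [exact (C2fun_comp _ _ _ _ _ _ (C2fun_affine (PI / 2) (-1)) (C2fun_prof_arc s Hs)) | ..];
      intros x; simpl; (replace (PI / 2 + -1 * x) with (PI / 2 - x) by ring); ring.
  - rewrite Rplus_0_r, Rminus_0_r; reflexivity.
  - rewrite Rplus_0_r, Rminus_0_r. unfold prof_arc1, glue. destruct (Rle_dec (PI / 2) 0); [lra|].
    rewrite cos_PI2; ring.
  - rewrite Rplus_0_r, Rminus_0_r; reflexivity.
Qed.

Lemma prof_abs (s x : R) :
  prof s x = prof_arc s (PI / 2 - Rabs x) /\
  (prof1 s x) ^ 2 = (prof_arc1 s (PI / 2 - Rabs x)) ^ 2 /\
  prof2 s x = prof_arc2 s (PI / 2 - Rabs x).
Proof.
  unfold prof, prof1, prof2, glue. destruct (Rle_dec x 0).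
  - rewrite Rabs_left1 by assumption. unfold Rminus; rewrite Ropp_involutive. tauto.
  - rewrite Rabs_pos_eq by lra. repeat split; ring.
Qed.

(** The last clause is conservation of energy for [F'' = - F]; it turns gradient terms into
    polynomials in [F]. The next lemma has the analogue for [F'' = - F / s ^ 2]. *)
Lemma prof_inner (s x : R) :
  Rabs x <= PI / 2 ->
  prof s x = cos x /\ prof2 s x = - prof s x /\ (prof1 s x) ^ 2 = 1 - (prof s x) ^ 2.
Proof.
  intros Hx. destruct (prof_abs s x) as (E0&E1&E2). set (t := PI / 2 - Rabs x) in *.
  assert (Z : 0 / s = 0) by (unfold Rdiv; ring).
  unfold prof_arc, prof_arc1, prof_arc2 in *.
  rewrite glue_right in E0, E1, E2
    by (unfold t; rewrite ?Z, ?sin_0, ?cos_0; lra || (unfold Rdiv; ring)).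
  rewrite E0, E1, E2. split; [|split].
  - unfold t. rewrite sin_shift. unfold Rabs; destruct (Rcase_abs x); [apply cos_neg | reflexivity].
  - reflexivity.
  - pose proof (sin2_cos2 t); unfold Rsqr in *; lra.
Qed.

Lemma prof_outer (s x : R) :
  s <> 0 -> PI / 2 <= Rabs x ->
  prof s x = - (s * sin ((Rabs x - PI / 2) / s)) /\
  prof2 s x = - prof s x / s ^ 2 /\ (prof1 s x) ^ 2 = 1 - (prof s x) ^ 2 / s ^ 2.
Proof.
  intros Hs Hx. destruct (prof_abs s x) as (E0&E1&E2). set (t := PI / 2 - Rabs x) in *.
  unfold prof_arc, prof_arc1, prof_arc2 in *.
  rewrite glue_left in E0, E1, E2 by (unfold t; lra).
  rewrite E0, E1, E2. split; [|split].
  - replace ((Rabs x - PI / 2) / s) with (- (t / s)) by (unfold t; field; exact Hs).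
    rewrite sin_neg; ring.
  - field; exact Hs.
  - pose proof (sin2_cos2 (t / s)); unfold Rsqr in *.
    replace ((s * sin (t / s)) ^ 2 / s ^ 2) with (sin (t / s) * sin (t / s)) by (field; exact Hs). lra.
Qed.

(** Here the outer arc reaches its minimum [- s], so this is where the profile stops decreasing in
    [|x|]. *)
Definition halfw (s : R) : R := PI / 2 + s * (PI / 2).

Lemma prof_decr (s x y : R) :
  1 <= s -> Rabs x < Rabs y -> Rabs y <= halfw s -> prof s y < prof s x.
Proof.
  intros Hs Hxy Hy. unfold halfw in Hy. pose proof PI_RGT_0. pose proof (Rabs_pos x).
  assert (I : forall x y, Rabs x < Rabs y -> Rabs y <= PI / 2 -> prof s y < prof s x).
  { intros a b Hab Hb. pose proof (Rabs_pos a).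
    destruct (prof_abs s a) as (-> & _), (prof_abs s b) as (-> & _). unfold prof_arc.
    assert (s * sin (0 / s) = sin 0) by (unfold Rdiv; rewrite Rmult_0_l, sin_0; ring).
    rewrite !glue_right by lra. apply sin_increasing_1; lra. }
  assert (O : forall x y, PI / 2 <= Rabs x -> Rabs x < Rabs y -> Rabs y <= PI / 2 + s * (PI / 2) ->
    prof s y < prof s x).
  { intros a b Ha Hab Hb.
    destruct (prof_outer s a) as (-> & _), (prof_outer s b) as (-> & _); try lra.
    apply Ropp_lt_contravar, Rmult_lt_compat_l; [lra|].
    assert ((Rabs a - PI / 2) / s < (Rabs b - PI / 2) / s).
    { apply Rmult_lt_compat_r; [apply Rinv_0_lt_compat|]; lra. }
    assert (0 <= (Rabs a - PI / 2) / s) by (apply Rdiv_le_0_compat; lra).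
    assert ((Rabs b - PI / 2) / s <= PI / 2) by (apply Rle_div_l; lra).
    apply sin_increasing_1; lra. }
  destruct (Rle_dec (Rabs y) (PI / 2)); [apply I; assumption|].
  destruct (Rle_dec (PI / 2) (Rabs x)); [apply O; assumption|].
  (* The two points lie on different arcs; they are compared through the junction [PI / 2]. *)
  assert (Rabs (PI / 2) = PI / 2) by (apply Rabs_pos_eq; lra).
  apply Rlt_trans with (prof s (PI / 2)); [apply O | apply I]; lra.
Qed.

Lemma prof_decr_le (s x y : R) :
  1 <= s -> Rabs x <= Rabs y -> Rabs y <= halfw s -> prof s y <= prof s x.
Proof.
  intros Hs [Hxy|Hxy] Hy; [left; apply prof_decr; assumption|].
  destruct (prof_abs s x) as (-> & _), (prof_abs s y) as (-> & _). rewrite Hxy; lra.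
Qed.

Lemma prof_0 (s : R) : prof s 0 = 1.
Proof.
  pose proof PI_RGT_0. destruct (prof_inner s 0) as (-> & _); [rewrite Rabs_R0; lra | apply cos_0].
Qed.

Lemma prof_le_1 (s x : R) : 1 <= s -> Rabs x <= halfw s -> prof s x <= 1.
Proof.
  intros Hs Hx. rewrite <- (prof_0 s). apply prof_decr_le; try assumption.
  rewrite Rabs_R0; apply Rabs_pos.
Qed.

Lemma prof_PI2 (s : R) : prof s (PI / 2) = 0.
Proof.
  pose proof PI_RGT_0.
  destruct (prof_inner s (PI / 2)) as (-> & _); [rewrite Rabs_pos_eq; lra | apply cos_PI2].
Qed.

Lemma prof_pos_inner (s x : R) : Rabs x <= PI / 2 -> 0 <= prof s x.
Proof.
  intros Hx. destruct (prof_inner s x Hx) as (-> & _). apply Rabs_le_between in Hx. apply cos_ge_0; lra.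
Qed.

Lemma prof_neg_outer (s x : R) : 1 <= s -> PI / 2 < Rabs x <= halfw s -> prof s x < 0.
Proof.
  intros Hs Hx. pose proof PI_RGT_0. rewrite <- (prof_PI2 s).
  apply prof_decr; [exact Hs | rewrite (Rabs_pos_eq (PI / 2)); lra | lra].
Qed.

Lemma prof_halfw (s x : R) : 1 <= s -> Rabs x = halfw s -> prof s x = - s.
Proof.
  intros Hs Hx. pose proof PI_RGT_0. unfold halfw in Hx.
  destruct (prof_outer s x) as (-> & _); [lra | nra |].
  rewrite Hx. replace ((PI / 2 + s * (PI / 2) - PI / 2) / s) with (PI / 2) by (field; lra).
  rewrite sin_PI2; ring.
Qed.

(** * The domain *)

Definition usum (s g x y : R) : R := g * prof s x + prof s y.

(** The outer arc oscillates, so [usum] is positive again farther out; the box keeps only the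
    component of the origin. *)
Definition inside (s g x y : R) : Prop := Rabs x < halfw s /\ Rabs y < halfw s /\ 0 < usum s g x y.
Definition inside_cl (s g x y : R) : Prop :=
  Rabs x <= halfw s /\ Rabs y <= halfw s /\ 0 <= usum s g x y.

Lemma lt_asin (t z : R) :
  - (PI / 2) <= t <= PI / 2 -> -1 <= z <= 1 -> (t < asin z <-> sin t < z).
Proof.
  intros Ht Hz. pose proof (asin_bound z). pose proof (sin_asin z Hz). split; intros H1.
  - rewrite <- H0. apply sin_increasing_1; lra.
  - apply sin_increasing_0; lra.
Qed.

Lemma le_asin (t z : R) :
  - (PI / 2) <= t <= PI / 2 -> -1 <= z <= 1 -> (t <= asin z <-> sin t <= z).
Proof.
  intros Ht Hz. pose proof (asin_bound z). pose proof (sin_asin z Hz). split; intros H1.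
  - rewrite <- H0. apply sin_incr_1; lra.
  - apply sin_incr_0; lra.
Qed.

Lemma lt_acos (t z : R) : 0 <= t <= PI -> -1 <= z <= 1 -> (t < acos z <-> z < cos t).
Proof.
  intros Ht Hz. pose proof (acos_bound z). pose proof (cos_acos z Hz). split; intros H1.
  - rewrite <- H0 at 1. apply cos_decreasing_1; lra.
  - apply cos_decreasing_0; lra.
Qed.

Lemma cos_Rabs (x : R) : cos (Rabs x) = cos x.
Proof. unfold Rabs; destruct (Rcase_abs x); [apply cos_neg | reflexivity]. Qed.

(** [|y| < phi_og om g x] is [usum > 0] solved for [|y|] by an arcsine or an arccosine. The cases
    are the inner square and the two outer strips; [|x|] and [|y|] cannot both exceed [PI / 2], as
    both profiles would be negative. The bounds on [g] keep the arcsine arguments at most 1. *)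
Lemma Omega_og_inside (om g x y : R) :
  1 <= sqrt om -> 1 <= g * sqrt om -> g <= sqrt om ->
  (Omega_og om g x y <-> inside (sqrt om) g x y).
Proof.
  set (s := sqrt om). intros Hs Hg1 Hg2. pose proof PI_RGT_0 as Hpi.
  assert (Hg : 0 < g) by nra.
  unfold Omega_og, phi_half_width, phi_og, inside. fold s.
  pose proof (Rabs_pos x) as Px. pose proof (Rabs_pos y) as Py.
  assert (Bgs : -1 <= 1 / (g * s) <= 1).
  { split; [apply Rle_trans with 0; [lra | apply Rdiv_le_0_compat; lra]
           | apply Rle_div_l; lra]. }
  assert (HW : 0 <= asin (1 / (g * s)) <= PI / 2).
  { split; [|apply asin_bound]. apply le_asin; [lra | exact Bgs |].
    rewrite sin_0. apply Rdiv_le_0_compat; lra. }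
  destruct (Rle_dec (Rabs x) (PI / 2)) as [Hx|Hx].
  - destruct (prof_inner s x Hx) as (Ex & _). pose proof (prof_pos_inner s x Hx) as Cx.
    rewrite Ex in Cx. pose proof (COS_bound x).
    set (A := g / s * cos x).
    assert (HA : 0 <= A <= 1).
    { unfold A. assert (0 <= g / s <= 1) by (split; [apply Rdiv_le_0_compat | apply Rle_div_l]; lra).
      split; nra. }
    assert (EA : s * A = g * cos x) by (unfold A; field; lra).
    assert (HasA : 0 <= asin A <= PI / 2).
    { split; [|apply asin_bound]. apply le_asin; [lra..|]. rewrite sin_0; lra. }
    unfold usum; rewrite Ex, <- EA. unfold halfw.
    destruct (Rle_dec (Rabs y) (PI / 2)) as [Hy|Hy].
    + destruct (prof_inner s y Hy) as (Ey & _). pose proof (prof_pos_inner s y Hy) as Cy.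
      rewrite Ey in *.
      (* On the inner square both summands are non-negative, so positivity fails only when [A = 0]
         and [|y| = PI / 2]. *)
      assert (K : 0 < A \/ Rabs y < PI / 2 <-> 0 < s * A + cos y).
      { split.
        - intros [K|K]; [nra|]. apply Rabs_def2 in K.
          assert (0 < cos y) by (apply cos_gt_0; lra). nra.
        - intros K. destruct (Rle_lt_or_eq_dec _ _ Hy) as [K1|K1]; [tauto|].
          left. rewrite <- cos_Rabs, K1, cos_PI2 in K. nra. }
      rewrite <- K. split.
      * intros [_ Hl]. repeat split; [nra.. |].
        destruct (Rle_lt_or_eq_dec _ _ Hy) as [K1|K1]; [tauto|]. left.
        assert (0 < asin A) by nra. rewrite <- sin_0. apply lt_asin; lra.
      * intros (_ & _ & [K1|K1]); (split; [nra|]); [|nra].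
        assert (0 < asin A) by (apply lt_asin; [lra..|]; rewrite sin_0; lra). nra.
    + destruct (prof_outer s y) as (Ey & _); [lra..|]. rewrite Ey.
      set (th := (Rabs y - PI / 2) / s).
      assert (Eth : Rabs y = PI / 2 + s * th) by (unfold th; field; lra).
      assert (Hth : 0 < th) by (unfold th; apply Rdiv_lt_0_compat; lra).
      rewrite Eth. split.
      * intros [_ Hl]. assert (th < asin A) by nra.
        assert (sin th < A) by (apply lt_asin; lra). repeat split; nra.
      * intros (_ & Hl & Hp). split; [nra|].
        assert (th < PI / 2) by nra.
        assert (th < asin A) by (apply lt_asin; nra). nra.
  - set (th := (Rabs x - PI / 2) / s).
    assert (Eth : Rabs x = PI / 2 + s * th) by (unfold th; field; lra).
    assert (Hth : 0 < th) by (unfold th; apply Rdiv_lt_0_compat; lra).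
    destruct (prof_outer s x) as (Ex & _); [lra..|]. fold th in Ex.
    unfold usum, halfw. split.
    + intros [Hw Hl].
      assert (Ht : th <= asin (1 / (g * s))) by nra.
      assert (Hst : sin th <= 1 / (g * s)) by (apply le_asin; lra).
      assert (0 < sin th) by (apply sin_gt_0; lra).
      (* The half-width condition amounts to [B <= 1], which makes [acos B] a true angle. *)
      set (B := g * s * sin th) in *.
      assert (HB : 0 <= B <= 1).
      { split; [unfold B; nra|]. apply Rle_div_r in Hst; unfold B; nra. }
      pose proof (acos_bound B).
      assert (HyB : B < cos (Rabs y)) by (apply lt_acos; lra).
      assert (Hy : Rabs y <= PI / 2).
      { apply Rnot_lt_le; intros Hy. assert (cos (Rabs y) <= 0) by (apply cos_le_0; lra). lra. }
      destruct (prof_inner s y Hy) as (Ey & _). rewrite cos_Rabs in HyB.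
      pose proof (COS_bound y).
      rewrite Ex, Ey. repeat split; [|nra | unfold B in *; nra].
      (* [Omega_og] bounds [|x|] non-strictly and [inside] strictly: at [th = PI / 2] one would have
         [B = g * s >= 1], against [B < cos y]. *)
      destruct (Rle_lt_or_eq_dec th (PI / 2)) as [|E]; [lra | nra |].
      unfold B in HyB; rewrite E, sin_PI2 in HyB. lra.
    + intros (Hw & Hl & Hp).
      assert (Ht : th < PI / 2) by nra.
      assert (0 < sin th) by (apply sin_gt_0; lra).
      assert (Hy : Rabs y <= PI / 2).
      { apply Rnot_lt_le; intros Hy.
        assert (prof s y < 0) by (apply prof_neg_outer; unfold halfw; lra).
        rewrite Ex in Hp. nra. }
      destruct (prof_inner s y Hy) as (Ey & _). rewrite Ex, Ey in Hp.
      set (B := g * s * sin th) in *. pose proof (COS_bound y).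
      assert (HB : 0 <= B < cos y) by (unfold B; split; nra).
      split.
      * assert (th < asin (1 / (g * s))).
        { apply lt_asin; [lra | exact Bgs |]. apply Rlt_div_r; unfold B in HB; nra. }
        nra.
      * apply lt_acos; [lra | lra |]. rewrite cos_Rabs; lra.
Qed.

(** For [|x| > PI / 2] the formula of [u_og] has [cos y] whatever [y] is; it agrees with the profile
    because [usum >= 0] then forces [|y| <= PI / 2]. The shifted cosines are negative sines. *)
Lemma u_og_usum (om g x y : R) :
  1 <= sqrt om -> 0 < g -> inside_cl (sqrt om) g x y -> u_og om g x y = usum (sqrt om) g x y.
Proof.
  set (s := sqrt om). intros Hs Hg (Hx & Hy & Hu). unfold u_og, usum in *. fold s.
  destruct (Rle_dec (Rabs x) (PI / 2)) as [Bx|Bx].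
  - destruct (prof_inner s x Bx) as (-> & _).
    destruct (Rle_dec (Rabs y) (PI / 2)) as [By|By].
    + destruct (prof_inner s y By) as (-> & _). reflexivity.
    + destruct (prof_outer s y) as (-> & _); [lra..|]. 
      rewrite (Rplus_comm _ (PI / 2)), (sin_cos ((Rabs y - PI / 2) / s)). ring.
  - assert (prof s x < 0) by (apply prof_neg_outer; lra).
    assert (By : Rabs y <= PI / 2).
    { apply Rnot_lt_le; intros By. assert (prof s y < 0) by (apply prof_neg_outer; lra). nra. }
    destruct (prof_inner s y By) as (-> & _).
    destruct (prof_outer s x) as (-> & _); [lra..|].
    rewrite (Rplus_comm _ (PI / 2)), (sin_cos ((Rabs x - PI / 2) / s)). ring.
Qed.

(** * Viscosity solutions *)

Lemma continuity_2d_lt (f : R -> R -> R) (m x y : R) :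
  continuity_2d_pt f x y -> m < f x y -> locally_2d (fun u v => m < f u v) x y.
Proof.
  intros Hf Hm. assert (He : 0 < f x y - m) by lra.
  destruct (Hf (mkposreal _ He)) as [d Hd]. exists d; intros u v Hu Hv.
  specialize (Hd u v Hu Hv); apply Rabs_def2 in Hd; simpl in Hd; lra.
Qed.

Lemma continuity_2d_gt (f : R -> R -> R) (m x y : R) :
  continuity_2d_pt f x y -> f x y < m -> locally_2d (fun u v => f u v < m) x y.
Proof.
  intros Hf Hm.
  destruct (continuity_2d_lt (fun u v => - f u v) (- m) x y) as [d Hd];
    [apply continuity_2d_pt_opp, Hf | lra |].
  exists d; intros u v Hu Hv; specialize (Hd u v Hu Hv); simpl in Hd; lra.
Qed.

Lemma continuity_2d_abs_x (x y : R) : continuity_2d_pt (fun u _ => Rabs u) x y.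
Proof.
  apply (continuity_1d_2d_pt_comp Rabs (fun u _ => u)); [apply Rcontinuity_abs | apply continuity_2d_pt_id1].
Qed.

Lemma continuity_2d_abs_y (x y : R) : continuity_2d_pt (fun _ v => Rabs v) x y.
Proof.
  apply (continuity_1d_2d_pt_comp Rabs (fun _ v => v)); [apply Rcontinuity_abs | apply continuity_2d_pt_id2].
Qed.

Lemma locally_2d_and3 (P Q T : R -> R -> Prop) (x y : R) :
  locally_2d P x y -> locally_2d Q x y -> locally_2d T x y ->
  locally_2d (fun u v => P u v /\ Q u v /\ T u v) x y.
Proof.
  intros HP HQ HT. apply locally_2d_and; [exact HP|]. apply locally_2d_and; assumption.
Qed.

Lemma lsc_of_continuity (K : R -> R -> Prop) (f : R -> R -> R) :
  (forall x y, K x y -> continuity_2d_pt f x y) -> lsc_on K f.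
Proof.
  intros Hf x y Hk m Hm. destruct (continuity_2d_lt f m x y (Hf x y Hk) Hm) as [d Hd].
  exists d; intros u v Hu Hv _; exact (Hd u v Hu Hv).
Qed.

Lemma usum_sepf (s g : R) :
  usum s g = sepf (fun x => g * prof s x) (prof s) (fun _ => 0) (fun _ => 0).
Proof.
  apply functional_extensionality; intros x; apply functional_extensionality; intros y.
  unfold usum, sepf; ring.
Qed.

Lemma C2fun_continuity (f f1 f2 : R -> R) (x : R) : C2fun f f1 f2 -> continuity_pt f x.
Proof. intros H. exact (is_derive_continuity_pt _ _ _ (proj1 (H x))). Qed.

Lemma continuity_usum (s g x y : R) : s <> 0 -> continuity_2d_pt (usum s g) x y.
Proof.
  intros Hs. rewrite usum_sepf. pose proof (C2fun_prof s Hs) as F.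
  apply continuity_sepf; [exact (C2fun_continuity _ _ _ x (C2fun_scal g _ _ _ F)) |
    exact (C2fun_continuity _ _ _ y F) | ..]; exact (C2fun_continuity _ _ _ _ (C2fun_const 0)).
Qed.

Lemma inside_open (s g x y : R) : s <> 0 -> inside s g x y -> locally_2d (inside s g) x y.
Proof.
  intros Hs (Hx & Hy & Hu). apply locally_2d_and3.
  - apply (continuity_2d_gt (fun u _ => Rabs u)); [apply continuity_2d_abs_x | exact Hx].
  - apply (continuity_2d_gt (fun _ v => Rabs v)); [apply continuity_2d_abs_y | exact Hy].
  - apply continuity_2d_lt; [apply continuity_usum, Hs | exact Hu].
Qed.

Lemma inside_cl_closed (s g x y : R) :
  s <> 0 -> ~ inside_cl s g x y -> locally_2d (fun u v => ~ inside_cl s g u v) x y.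
Proof.
  intros Hs Hn. unfold inside_cl in *.
  destruct (Rle_dec (Rabs x) (halfw s)) as [Hx|Hx].
  - destruct (Rle_dec (Rabs y) (halfw s)) as [Hy|Hy].
    + destruct (continuity_2d_gt (usum s g) 0 x y) as [d Hd];
        [apply continuity_usum, Hs | apply Rnot_le_lt; tauto |].
      exists d; intros u v Hu Hv (_ & _ & H). specialize (Hd u v Hu Hv); lra.
    + destruct (continuity_2d_lt (fun _ v => Rabs v) (halfw s) x y) as [d Hd];
        [apply continuity_2d_abs_y | lra |].
      exists d; intros u v Hu Hv (_ & H & _). specialize (Hd u v Hu Hv); simpl in Hd; lra.
  - destruct (continuity_2d_lt (fun u _ => Rabs u) (halfw s) x y) as [d Hd];
      [apply continuity_2d_abs_x | lra |].
    exists d; intros u v Hu Hv (H & _). specialize (Hd u v Hu Hv); simpl in Hd; lra.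
Qed.

(** On the sides of the box one profile equals [- s], so [usum] is at most [1 - g * s] or [g - s],
    and both are non-positive. *)
Lemma inside_of_cl (s g x y : R) :
  1 <= s -> 1 <= g * s -> g <= s -> inside_cl s g x y -> 0 < usum s g x y -> inside s g x y.
Proof.
  intros Hs Hg1 Hg2 (Hx & Hy & _) Hu. unfold usum in Hu.
  pose proof (prof_le_1 s x Hs Hx). pose proof (prof_le_1 s y Hs Hy). assert (0 < g) by nra.
  repeat split; try assumption.
  - destruct Hx as [|Hx]; [assumption|]. rewrite (prof_halfw s x Hs Hx) in Hu. nra.
  - destruct Hy as [|Hy]; [assumption|]. rewrite (prof_halfw s y Hs Hy) in Hu. nra.
Qed.

Lemma inside_mono (s g x y x' y' : R) :
  1 <= s -> 0 < g -> inside s g x y -> Rabs x' <= Rabs x -> Rabs y' <= Rabs y -> inside s g x' y'.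
Proof.
  intros Hs Hg (Hx & Hy & Hu) Hx' Hy'. unfold usum in Hu. repeat split; try lra.
  assert (prof s x <= prof s x') by (apply prof_decr_le; lra).
  assert (prof s y <= prof s y') by (apply prof_decr_le; lra).
  unfold usum; nra.
Qed.

Lemma inside_0 (s g : R) : 1 <= s -> 0 < g -> inside s g 0 0.
Proof.
  intros Hs Hg. pose proof PI_RGT_0.
  unfold inside, usum, halfw; rewrite Rabs_R0, prof_0. repeat split; nra.
Qed.

Lemma cont_on_continuity (O : Defs.domain) (u : R -> R -> R) (x y : R) :
  cont_on O u -> locally_2d O x y -> continuity_2d_pt u x y.
Proof.
  intros Hu HO eps.
  destruct (Hu x y (locally_2d_singleton _ _ _ HO) eps (cond_pos eps)) as [d [Pd Hd]].
  destruct HO as [r Hr].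
  assert (Hm : 0 < Rmin (d / 2) r) by (apply Rmin_glb_lt; [lra | apply cond_pos]).
  exists (mkposreal _ Hm); simpl; intros a b Ha Hb.
  pose proof (Rmin_l (d / 2) r). pose proof (Rmin_r (d / 2) r).
  apply Hd; [apply Hr; lra | apply dist2_lt_of_box; lra].
Qed.

Lemma cont_on_of_continuity (O : Defs.domain) (u : R -> R -> R) :
  (forall x y, continuity_2d_pt u x y) -> cont_on O u.
Proof.
  intros Hu x y _ eps He. destruct (proj2 (cont2_at_2d u x y) (Hu x y) eps He) as [d [Pd Hd]].
  exists d; split; [exact Pd | intros a b _; apply Hd].
Qed.

(* The diagonal matrix [diag (wt x, wt y)] is the one attaining [M+] at [D^2 u]. *)
Definition wt (lam Lam x : R) : R := if Rle_dec (Rabs x) (PI / 2) then lam else Lam.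

Lemma wt_bound (lam Lam x : R) : lam <= Lam -> lam <= wt lam Lam x <= Lam.
Proof. intros H; unfold wt; destruct (Rle_dec (Rabs x) (PI / 2)); lra. Qed.

(** The weight absorbs the factor [s ^ 2 = Lam / lam], merging [F'' = - F] and [F'' = - F / s ^ 2]
    into a single linear equation. *)
Lemma wt_prof2 (lam s x : R) : s <> 0 -> wt lam (lam * s ^ 2) x * prof2 s x = - lam * prof s x.
Proof.
  intros Hs; unfold wt; destruct (Rle_dec (Rabs x) (PI / 2)) as [Hx|Hx].
  - destruct (prof_inner s x Hx) as (_ & -> & _); ring.
  - destruct (prof_outer s x) as (_ & -> & _); [exact Hs | lra | field; exact Hs].
Qed.

Lemma le_mult_sqr (lam s : R) : 0 < lam -> 1 <= s -> lam <= lam * s ^ 2.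
Proof. intros Hl Hs. assert (1 <= s ^ 2) by nra. nra. Qed.

(** Up to [halfw] the signs of [F] and [F''] are opposite, so the nonlinear term selects exactly the
    coefficient [wt]. *)
Lemma pucci_term_prof2 (lam s x : R) :
  0 < lam -> 1 <= s -> Rabs x <= halfw s ->
  forall c, 0 < c -> pucci_term lam (lam * s ^ 2) (c * prof2 s x) = - lam * (c * prof s x).
Proof.
  intros Hl Hs Hx c Hc. pose proof (le_mult_sqr lam s Hl Hs). rewrite pucci_term_max by assumption.
  destruct (Rle_dec (Rabs x) (PI / 2)) as [Bx|Bx].
  - pose proof (prof_pos_inner s x Bx). destruct (prof_inner s x Bx) as (_ & -> & _).
    rewrite Rmax_left; [ring|]. assert (0 <= c * prof s x) by nra.
    assert (0 <= (lam * s ^ 2 - lam) * (c * prof s x)) by (apply Rmult_le_pos; lra). lra.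
  - assert (prof s x < 0) by (apply prof_neg_outer; lra).
    destruct (prof_outer s x) as (_ & -> & _); [lra..|].
    assert (0 <= c * (- prof s x / s ^ 2)).
    { apply Rmult_le_pos; [lra|]. apply Rdiv_le_0_compat; nra. }
    rewrite Rmax_right; [field; lra |]. 
    assert (0 <= (lam * s ^ 2 - lam) * (c * (- prof s x / s ^ 2))) by (apply Rmult_le_pos; lra). lra.
Qed.

Lemma C2_usum (lam s g : R) :
  0 < lam -> 1 <= s -> 0 < g ->
  C2 (usum s g) /\
  forall x y, inside s g x y ->
    pucci_hess lam (lam * s ^ 2) (usum s g) x y = - lam * usum s g x y.
Proof.
  intros Hl Hs Hg. assert (Hs0 : s <> 0) by lra. pose proof (C2fun_prof s Hs0) as F.
  pose proof (C2_sepf _ _ _ _ _ _ _ _ _ _ _ _ (C2fun_scal g _ _ _ F) F (C2fun_const 0) (C2fun_const 0))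
    as [H1 H2].
  rewrite <- usum_sepf in *. split; [exact H1|]. intros x y (Hx & Hy & _). rewrite H2.
  rewrite !Rmult_0_l, !Rplus_0_r, pucci_diag.
  rewrite pucci_term_prof2 by lra.
  replace (prof2 s y) with (1 * prof2 s y) by ring.
  rewrite pucci_term_prof2 by lra. unfold usum; ring.
Qed.

Lemma visc_sol_ext (lam Lam mu : R) (O : Defs.domain) (u v : R -> R -> R) :
  (forall x y, O x y -> u x y = v x y) -> visc_sol lam Lam mu O u -> visc_sol lam Lam mu O v.
Proof.
  intros E [[Hc H1] [_ H2]].
  assert (Hc' : cont_on O v).
  { intros x y Hxy eps He. destruct (Hc x y Hxy eps He) as [d [Pd Hd]].
    exists d; split; [exact Pd|]. intros a b Hab; rewrite <- !E by assumption; auto. }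
  split; (split; [exact Hc'|]); intros phi x y Hphi Hxy [r [Pr Hr]]; rewrite <- E by assumption;
    [apply H1 | apply H2]; try assumption;
    exists r; (split; [exact Pr|]); intros a b Hab; rewrite !E by assumption; auto.
Qed.

(** A classical solution is a viscosity solution: at a touching point the second-order condition
    orders the values of [M+] at the two Hessians. *)
Lemma usum_visc_sol (lam s g : R) :
  0 < lam -> 1 <= s -> 0 < g -> visc_sol lam (lam * s ^ 2) lam (inside s g) (usum s g).
Proof.
  intros Hl Hs Hg. assert (Hs0 : s <> 0) by lra. pose proof (le_mult_sqr lam s Hl Hs) as HL.
  destruct (C2_usum lam s g Hl Hs Hg) as [H1 H2].
  assert (Hc : cont_on (inside s g) (usum s g)).
  { apply cont_on_of_continuity; intros; apply continuity_usum, Hs0. }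
  assert (Loc : forall (P : R -> R -> Prop) x y r, 0 < r -> inside s g x y ->
    (forall a b, inside s g a b -> dist2 a b x y < r -> P a b) -> locally_2d P x y).
  { intros P x y r Pr Hxy Hr. destruct (inside_open s g x y Hs0 Hxy) as [d Hd].
    assert (Hm : 0 < Rmin (r / 2) d) by (apply Rmin_glb_lt; [lra | apply cond_pos]).
    exists (mkposreal _ Hm); simpl; intros a b Ha Hb.
    pose proof (Rmin_l (r / 2) d). pose proof (Rmin_r (r / 2) d).
    apply Hr; [apply Hd; lra | apply dist2_lt_of_box; lra]. }
  split; (split; [exact Hc|]); intros phi x y Hphi Hxy [r [Pr Hr]].
  - pose proof (pucci_hess_le_of_min lam _ _ _ x y Hl HL H1 Hphi (Loc _ x y r Pr Hxy Hr)) as H.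
    rewrite H2 in H by assumption. lra.
  - assert (H : pucci_hess lam (lam * s ^ 2) (usum s g) x y <= pucci_hess lam (lam * s ^ 2) phi x y).
    { apply pucci_hess_le_of_min; try assumption. apply (Loc _ x y r Pr Hxy).
      intros a b Hab Hd. specialize (Hr a b Hab Hd). lra. }
    rewrite H2 in H by assumption. lra.
Qed.

(** The linear form of the supersolution property: [M+] dominates the operator with coefficients
    [wt x], [wt y], of which [usum] is an exact solution. Touching is stated by increments, so
    constants in the test function may be dropped. *)
Lemma super_touch (lam Lam mu : R) (O : Defs.domain) (v : R -> R -> R)
  (A A1 A2 B B1 B2 C C1 C2 D D1 D2 : R -> R) (x y : R) :
  0 < lam -> lam <= Lam -> visc_super lam Lam mu O v ->
  C2fun A A1 A2 -> C2fun B B1 B2 -> C2fun C C1 C2 -> C2fun D D1 D2 -> O x y ->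
  locally_2d (fun a b => O a b -> v x y - sepf A B C D x y <= v a b - sepf A B C D a b) x y ->
  wt lam Lam x * (A2 x + C2 x * D y) + wt lam Lam y * (B2 y + C x * D2 y) + mu * v x y <= 0.
Proof.
  intros Hl HL [_ Hv] HA HB HC HD Hxy [r Hr].
  pose proof (C2_sepf _ _ _ _ _ _ _ _ _ _ _ _ HA HB HC HD) as [H1 H2].
  assert (H : pucci_hess lam Lam (sepf A B C D) x y + mu * v x y <= 0).
  { apply Hv; try assumption. exists r; split; [apply cond_pos|].
    intros a b Hab Hd. apply box_lt_of_dist2 in Hd. apply Hr; tauto. }
  rewrite H2 in H.
  pose proof (pucci_ge_diag lam Lam (wt lam Lam x) (wt lam Lam y) (A2 x + C2 x * D y) (C1 x * D1 y)
    (B2 y + C x * D2 y) Hl (wt_bound _ _ x HL) (wt_bound _ _ y HL)).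
  lra.
Qed.

(** * Strong minimum principle *)

Lemma C2fun_gauss (a p : R) :
  C2fun (fun x => exp (- a * (x - p) ^ 2))
        (fun x => - 2 * a * (x - p) * exp (- a * (x - p) ^ 2))
        (fun x => (4 * a ^ 2 * (x - p) ^ 2 - 2 * a) * exp (- a * (x - p) ^ 2)).
Proof.
  intros x; split; [|split].
  - auto_derive; trivial.
    replace (- a * ((x + - p) * ((x + - p) * 1))) with (- a * (x - p) ^ 2) by ring. ring.
  - auto_derive; trivial.
    replace (- a * ((x + - p) * ((x + - p) * 1))) with (- a * (x - p) ^ 2) by ring. ring.
  - eapply is_derive_continuity_pt. auto_derive; trivial; reflexivity.
Qed.

Definition sqdist (p1 p2 x y : R) : R := (x - p1) ^ 2 + (y - p2) ^ 2.

Lemma continuity_sqdist (p1 p2 x y : R) : continuity_2d_pt (sqdist p1 p2) x y.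
Proof.
  unfold sqdist. apply continuity_2d_pt_plus.
  - apply (continuity_1d_2d_pt_comp (fun t => (t - p1) ^ 2) (fun u _ => u)); [|apply continuity_2d_pt_id1].
    eapply is_derive_continuity_pt. auto_derive; trivial; reflexivity.
  - apply (continuity_1d_2d_pt_comp (fun t => (t - p2) ^ 2) (fun _ v => v)); [|apply continuity_2d_pt_id2].
    eapply is_derive_continuity_pt. auto_derive; trivial; reflexivity.
Qed.

Lemma sqdist_bound (p1 p2 x y R0 : R) :
  0 <= R0 -> sqdist p1 p2 x y <= R0 ^ 2 -> Rabs (x - p1) <= R0 /\ Rabs (y - p2) <= R0.
Proof.
  unfold sqdist; intros H0 H.
  pose proof (pow2_ge_0 (x - p1)). pose proof (pow2_ge_0 (y - p2)).
  split; rewrite <- (Rabs_pos_eq R0) by assumption;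
    apply Rsqr_le_abs_0; unfold Rsqr; lra.
Qed.

(* Hopf's barrier: away from the centre, [exp (- a * r^2)] is a strict subsolution for large [a]. *)
Lemma positivity_spreads (lam s g c R0 p1 p2 : R) (v : R -> R -> R) :
  0 < lam -> 1 <= s -> 0 < g -> visc_super lam (lam * s ^ 2) lam (inside s g) v ->
  (forall x y, inside s g x y -> c * usum s g x y <= v x y) ->
  0 < R0 -> (forall x y, sqdist p1 p2 x y <= R0 ^ 2 -> inside s g x y) ->
  c * usum s g p1 p2 < v p1 p2 ->
  forall x y, sqdist p1 p2 x y < R0 ^ 2 -> c * usum s g x y < v x y.
Proof.
  intros Hl Hs Hg Hv Hc HR HB Hp x y Hxy. assert (Hs0 : s <> 0) by lra.
  pose proof (le_mult_sqr lam s Hl Hs) as HL. set (Lam := lam * s ^ 2) in *.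
  pose proof (C2fun_prof s Hs0) as F.
  assert (Cw : forall x y, inside s g x y -> continuity_2d_pt (fun x y => v x y - c * usum s g x y) x y).
  { intros a b Hab. apply continuity_2d_pt_minus.
    - apply (cont_on_continuity (inside s g)); [apply Hv | apply inside_open; assumption].
    - apply continuity_2d_pt_mult; [apply continuity_2d_pt_const | apply continuity_usum, Hs0]. }
  assert (Hpin : inside s g p1 p2).
  { apply HB. unfold sqdist. replace ((p1 - p1) ^ 2 + (p2 - p2) ^ 2) with 0 by ring. nra. }
  (* By continuity [v - c * usum] stays above half of its central value on a ball of radius
     [rho < R0]. *)
  set (m := (v p1 p2 - c * usum s g p1 p2) / 2).
  assert (Hm : 0 < m) by (unfold m; lra).
  destruct (continuity_2d_lt _ m p1 p2 (Cw p1 p2 Hpin)) as [d Hd]; [unfold m; lra|].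
  set (rho := Rmin d R0 / 2).
  assert (Hrho : 0 < rho /\ rho < d /\ rho < R0).
  { pose proof (cond_pos d). unfold rho, Rmin; destruct (Rle_dec d R0); lra. }
  assert (Hin : forall x y, sqdist p1 p2 x y <= rho ^ 2 -> m < v x y - c * usum s g x y).
  { intros a b Hab. apply sqdist_bound in Hab; [|lra]. apply Hd; lra. }
  destruct (Rle_dec (sqdist p1 p2 x y) (rho ^ 2)) as [Hn|Hn]; [specialize (Hin x y Hn); lra|].
  (* With this [a], beyond distance [rho] the positive term of the Hessian factor exceeds
     [4 * a ^ 2 * lam * rho ^ 2 = 8 * a * Lam], while the negative one is at most [4 * a * Lam]. *)
  set (a := 2 * Lam / (lam * rho ^ 2)).
  assert (Ha : 0 < a) by (unfold a; apply Rdiv_lt_0_compat; [lra | apply Rmult_lt_0_compat; nra]).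
  assert (Ea : a * (lam * rho ^ 2) = 2 * Lam) by (unfold a; field; split; lra).
  set (e := fun x y => exp (- a * (x - p1) ^ 2) * exp (- a * (y - p2) ^ 2)).
  assert (Ee : forall x y, e x y = exp (- a * sqdist p1 p2 x y)).
  { intros x' y'; unfold e, sqdist. rewrite <- exp_plus. f_equal; ring. }
  set (z := exp (- a * R0 ^ 2)).
  (* The barrier [m * (e - z)] vanishes on the outer circle and is below [m] on the inner one. Since
     [e > z] at the given point, [f >= 0] on the annulus [K] suffices. *)
  set (f := fun x y => (v x y - c * usum s g x y) - m * (e x y - z)).
  set (K := fun x y => rho ^ 2 <= sqdist p1 p2 x y <= R0 ^ 2).
  assert (Ce : forall x y, continuity_2d_pt e x y).
  { intros x' y'; unfold e. apply continuity_2d_pt_mult.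
    - apply (continuity_1d_2d_pt_comp (fun t => exp (- a * (t - p1) ^ 2)) (fun u _ => u));
        [apply (C2fun_continuity _ _ _ _ (C2fun_gauss a p1)) | apply continuity_2d_pt_id1].
    - apply (continuity_1d_2d_pt_comp (fun t => exp (- a * (t - p2) ^ 2)) (fun _ v => v));
        [apply (C2fun_continuity _ _ _ _ (C2fun_gauss a p2)) | apply continuity_2d_pt_id2]. }
  destruct (lsc_attains_min K f (Rabs p1 + Rabs p2 + R0) x y) as (x1 & y1 & HK & Hmin).
  - unfold K; lra.
  - intros x' y' [_ H']. apply sqdist_bound in H'; [|lra].
    pose proof (Rabs_triang (x' - p1) p1). pose proof (Rabs_triang (y' - p2) p2).
    replace (x' - p1 + p1) with x' in * by ring. replace (y' - p2 + p2) with y' in * by ring.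
    pose proof (Rabs_pos p1); pose proof (Rabs_pos p2). lra.
  - intros x' y' H'. unfold K in H'. destruct (Rle_dec (rho ^ 2) (sqdist p1 p2 x' y')) as [H2|H2].
    + destruct (continuity_2d_lt (sqdist p1 p2) (R0 ^ 2) x' y') as [r Hr];
        [apply continuity_sqdist | lra |].
      exists r; intros b1 b2 Hb1 Hb2; specialize (Hr b1 b2 Hb1 Hb2); unfold K; lra.
    + destruct (continuity_2d_gt (sqdist p1 p2) (rho ^ 2) x' y') as [r Hr];
        [apply continuity_sqdist | lra |].
      exists r; intros b1 b2 Hb1 Hb2; specialize (Hr b1 b2 Hb1 Hb2); unfold K; lra.
  - apply lsc_of_continuity. intros x' y' H'. unfold f.
    apply continuity_2d_pt_minus; [apply Cw, HB, H'|].
    apply continuity_2d_pt_mult; [apply continuity_2d_pt_const|].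
    apply continuity_2d_pt_minus; [apply Ce | apply continuity_2d_pt_const].
  - assert (Hez : z < e x y).
    { rewrite Ee; unfold z. apply exp_increasing. nra. }
    assert (Hfx : f x1 y1 <= f x y) by (apply Hmin; unfold K; lra).
    destruct (Rle_dec 0 (f x1 y1)) as [H0|H0].
    { unfold f in *. assert (0 < m * (e x y - z)) by (apply Rmult_lt_0_compat; lra). lra. }
    (* A negative minimum lies in the open annulus, and there [c * usum + m * e] touches [v] from
       below up to a constant. *)
    exfalso. unfold K in HK.
    assert (Hin1 : inside s g x1 y1) by (apply HB; lra).
    specialize (Hc x1 y1 Hin1).
    assert (N1 : sqdist p1 p2 x1 y1 < R0 ^ 2).
    { destruct (proj2 HK) as [|E]; [assumption|]. exfalso; apply H0.
      unfold f; rewrite Ee, E; fold z. lra. }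
    assert (N2 : rho ^ 2 < sqdist p1 p2 x1 y1).
    { destruct (proj1 HK) as [|E]; [assumption|]. exfalso; apply H0.
      assert (m < v x1 y1 - c * usum s g x1 y1) by (apply Hin; lra).
      assert (e x1 y1 <= 1).
      { pose proof (pow2_ge_0 rho).
        assert (Hnn : 0 <= a * sqdist p1 p2 x1 y1) by (apply Rmult_le_pos; lra).
        rewrite Ee, <- exp_0.
        destruct (Rle_lt_or_eq_dec _ _ Hnn).
        - left; apply exp_increasing; lra.
        - right; f_equal; lra. }
      assert (0 < z) by apply exp_pos.
      assert (m * (e x1 y1 - z) <= m * 1) by (apply Rmult_le_compat_l; lra).
      unfold f; lra. }
    assert (T := super_touch lam Lam lam (inside s g) v _ _ _ _ _ _ _ _ _ _ _ _ x1 y1 Hl HL Hv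
      (C2fun_scal (c * g) _ _ _ F) (C2fun_scal c _ _ _ F)
      (C2fun_scal m _ _ _ (C2fun_gauss a p1)) (C2fun_gauss a p2) Hin1).
    pose proof (wt_bound lam Lam x1 HL) as W1. pose proof (wt_bound lam Lam y1 HL) as W2.
    pose proof (wt_prof2 lam s x1 Hs0) as P1. pose proof (wt_prof2 lam s y1 Hs0) as P2.
    fold Lam in P1, P2.
    set (al := wt lam Lam x1) in *. set (be := wt lam Lam y1) in *.
    assert (T' : al * (c * g * prof2 s x1) + be * (c * prof2 s y1)
       + m * e x1 y1 * (4 * a ^ 2 * (al * (x1 - p1) ^ 2 + be * (y1 - p2) ^ 2) - 2 * a * (al + be))
       + lam * v x1 y1 <= 0).
    { unfold e. eapply Rle_trans; [|apply T]; [right; ring|].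
      destruct (continuity_2d_lt (sqdist p1 p2) (rho ^ 2) x1 y1) as [r1 Hr1];
        [apply continuity_sqdist | exact N2 |].
      destruct (continuity_2d_gt (sqdist p1 p2) (R0 ^ 2) x1 y1) as [r2 Hr2];
        [apply continuity_sqdist | exact N1 |].
      exists (mkposreal _ (Rmin_stable_in_posreal r1 r2)); intros b1 b2 Hb1 Hb2 _; simpl in Hb1, Hb2.
      pose proof (Rmin_l r1 r2). pose proof (Rmin_r r1 r2).
      assert (Hf : f x1 y1 <= f b1 b2).
      { apply Hmin; unfold K. specialize (Hr1 b1 b2 ltac:(lra) ltac:(lra)).
        specialize (Hr2 b1 b2 ltac:(lra) ltac:(lra)). lra. }
      unfold f, e, usum in Hf. unfold sepf. cbv beta in *. lra. }
    assert (Pe : 0 < m * e x1 y1).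
    { apply Rmult_lt_0_compat; [exact Hm | rewrite Ee; apply exp_pos]. }
    assert (Q : 0 < 4 * a ^ 2 * (al * (x1 - p1) ^ 2 + be * (y1 - p2) ^ 2) - 2 * a * (al + be)).
    { unfold sqdist in N2.
      pose proof (pow2_ge_0 (x1 - p1)). pose proof (pow2_ge_0 (y1 - p2)).
      assert (lam * rho ^ 2 < al * (x1 - p1) ^ 2 + be * (y1 - p2) ^ 2).
      { apply Rlt_le_trans with (lam * ((x1 - p1) ^ 2 + (y1 - p2) ^ 2)); [|nra].
        apply Rmult_lt_compat_l; assumption. }
      assert (2 * Lam < a * (al * (x1 - p1) ^ 2 + be * (y1 - p2) ^ 2)) by nra.
      nra. }
    assert (0 < m * e x1 y1 * (4 * a ^ 2 * (al * (x1 - p1) ^ 2 + be * (y1 - p2) ^ 2) - 2 * a * (al + be)))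
      by (apply Rmult_lt_0_compat; assumption).
    assert (E1 : al * (c * g * prof2 s x1) + be * (c * prof2 s y1) = - lam * (c * usum s g x1 y1)).
    { replace (al * (c * g * prof2 s x1)) with (c * g * (al * prof2 s x1)) by ring.
      replace (be * (c * prof2 s y1)) with (c * (be * prof2 s y1)) by ring.
      rewrite P1, P2. unfold usum; ring. }
    assert (0 <= lam * (v x1 y1 - c * usum s g x1 y1)) by (apply Rmult_le_pos; lra).
    lra.
Qed.

(** Induction on the number of steps of length at most [h]; the point [a + (t - a) * (N / (N + 1))]
    is the last stop before [t]. *)
Lemma interval_chain (P : R -> Prop) (h a b : R) :
  0 < h -> (forall t u, 0 <= t <= 1 -> 0 <= u <= 1 -> Rabs (t - u) <= h -> P u -> P t) ->
  0 <= a <= 1 -> 0 <= b <= 1 -> P a -> P b.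
Proof.
  intros Hh Hs Ha Hb HP.
  assert (I : forall n t, 0 <= t <= 1 -> Rabs (t - a) <= INR n * h -> P t).
  { induction n as [|n IH]; intros t Ht Hta.
    - simpl in Hta. replace t with a; [exact HP|].
      pose proof (Rabs_pos (t - a)). assert (E : Rabs (t - a) = 0) by lra.
      apply Rabs_eq_0 in E; lra.
    - rewrite S_INR in Hta. pose proof (pos_INR n) as Hn. set (N := INR n) in *.
      assert (Hq : 0 <= N / (N + 1) <= 1) by (split; [apply Rdiv_le_0_compat | apply Rle_div_l]; lra).
      apply (Hs t (a + (t - a) * (N / (N + 1)))); [exact Ht | split; nra | |].
      + replace (t - (a + (t - a) * (N / (N + 1)))) with ((t - a) * / (N + 1)) by (field; lra).
        rewrite Rabs_mult, (Rabs_pos_eq (/ (N + 1))) by (left; apply Rinv_0_lt_compat; lra).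
        apply Rle_div_l; lra.
      + apply IH; [split; nra|].
        replace (a + (t - a) * (N / (N + 1)) - a) with ((t - a) * (N / (N + 1))) by ring.
        rewrite Rabs_mult, (Rabs_pos_eq (N / (N + 1))) by lra.
        replace (Rabs (t - a) * (N / (N + 1))) with (Rabs (t - a) / (N + 1) * N) by (field; lra).
        assert (Rabs (t - a) / (N + 1) <= h) by (apply Rle_div_l; lra). nra. }
  destruct (INR_unbounded (1 / h)) as [n Hn].
  apply (I n b Hb). apply Rle_trans with 1; [apply Rabs_le; lra|].
  apply Rgt_lt in Hn. apply Rlt_div_l in Hn; lra.
Qed.

(** Strict inequality spreads along the segment from one point to the origin, and from there to any
    other point. By [inside_mono] the balls centred on a segment can be given a common radius. *)
Lemma strong_minimum (lam s g c : R) (v : R -> R -> R) :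
  0 < lam -> 1 <= s -> 0 < g -> visc_super lam (lam * s ^ 2) lam (inside s g) v ->
  (forall x y, inside s g x y -> c * usum s g x y <= v x y) ->
  (exists x y, inside s g x y /\ c * usum s g x y < v x y) ->
  forall x y, inside s g x y -> c * usum s g x y < v x y.
Proof.
  intros Hl Hs Hg Hv Hc (p & q & Hpq & Hlt) x y Hxy. assert (Hs0 : s <> 0) by lra.
  assert (Seg : forall z1 z2 a b, inside s g z1 z2 -> 0 <= a <= 1 -> 0 <= b <= 1 ->
    c * usum s g (a * z1) (a * z2) < v (a * z1) (a * z2) ->
    c * usum s g (b * z1) (b * z2) < v (b * z1) (b * z2)).
  { intros z1 z2 a b Hz Ha Hb.
    assert (Hz' : inside s g (Rabs z1) (Rabs z2)).
    { apply (inside_mono s g z1 z2); try assumption; rewrite Rabs_Rabsolu; lra. }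
    destruct (inside_open s g _ _ Hs0 Hz') as [d Hd]. pose proof (cond_pos d) as Pd.
    pose proof (Rabs_pos z1). pose proof (Rabs_pos z2).
    assert (Hz2 : inside s g (Rabs z1 + d / 2) (Rabs z2 + d / 2)).
    { apply Hd; match goal with |- Rabs ?t < _ => replace t with (d / 2) by ring end;
        rewrite Rabs_pos_eq; lra. }
    (* A parameter step of size [h] moves the point by at most [d / 4], well within the ball of
       radius [d / 2] in which positivity spreads. *)
    set (h := d / 2 / (2 * (1 + Rabs z1 + Rabs z2))).
    assert (Hh : 0 < h) by (unfold h; apply Rdiv_lt_0_compat; lra).
    assert (Eh : h * (1 + Rabs z1 + Rabs z2) = d / 4) by (unfold h; field; lra).
    apply (interval_chain (fun t => c * usum s g (t * z1) (t * z2) < v (t * z1) (t * z2)) h);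
      try assumption.
    intros t u Ht Hu Htu Hlt'.
    assert (B : forall r w, 0 <= r <= 1 -> Rabs (r * w) <= Rabs w).
    { intros r w Hr. rewrite Rabs_mult, (Rabs_pos_eq r) by lra. pose proof (Rabs_pos w). nra. }
    apply (positivity_spreads lam s g c (d / 2) (u * z1) (u * z2)); try assumption; [lra | |].
    - intros a' b' Hab. apply sqdist_bound in Hab; [|lra].
      pose proof (Rabs_triang (a' - u * z1) (u * z1)). pose proof (Rabs_triang (b' - u * z2) (u * z2)).
      replace (a' - u * z1 + u * z1) with a' in * by ring.
      replace (b' - u * z2 + u * z2) with b' in * by ring.
      pose proof (B u z1 Hu). pose proof (B u z2 Hu).
      apply (inside_mono s g _ _ a' b' Hs Hg Hz2); rewrite (Rabs_pos_eq (_ + _)) by lra; lra.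
    - unfold sqdist.
      replace ((t * z1 - u * z1) ^ 2 + (t * z2 - u * z2) ^ 2) with
        ((Rabs (t - u)) ^ 2 * ((Rabs z1) ^ 2 + (Rabs z2) ^ 2)) by (rewrite !pow2_abs; ring).
      pose proof (Rabs_pos (t - u)).
      apply Rle_lt_trans with ((Rabs (t - u) * (1 + Rabs z1 + Rabs z2)) ^ 2).
      + rewrite Rpow_mult_distr. apply Rmult_le_compat_l; [apply pow2_ge_0 | nra].
      + assert (Rabs (t - u) * (1 + Rabs z1 + Rabs z2) <= d / 4) by (rewrite <- Eh; apply Rmult_le_compat_r; lra).
        assert (0 <= Rabs (t - u) * (1 + Rabs z1 + Rabs z2)) by (apply Rmult_le_pos; lra).
        nra. }
  specialize (Seg x y 0 1 Hxy) as Seg2. specialize (Seg p q 1 0 Hpq).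
  rewrite !Rmult_0_l, !Rmult_1_l in *. apply Seg2; [lra..|]. apply Seg; lra.
Qed.

(** * Comparison near the boundary and uniqueness *)

(** The cube of the positive part; 3 is the least integer exponent that makes it C^2. *)
Definition cub : R -> R := glue 0 (fun _ => 0) (fun t => t ^ 3).
Definition cub1 : R -> R := glue 0 (fun _ => 0) (fun t => 3 * t ^ 2).
Definition cub2 : R -> R := glue 0 (fun _ => 0) (fun t => 6 * t).

Lemma C2fun_cub : C2fun cub cub1 cub2.
Proof.
  apply C2fun_glue; try ring; [apply C2fun_const|].
  intros x; split; [|split].
  - auto_derive; trivial; ring.
  - auto_derive; trivial; ring.
  - apply (is_derive_continuity_pt (fun t => 6 * t) x 6). auto_derive; trivial; ring.
Qed.

Lemma cub_nonneg (t : R) : 0 <= t -> cub t = t ^ 3 /\ cub1 t = 3 * t ^ 2 /\ cub2 t = 6 * t.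
Proof.
  intros Ht; unfold cub, cub1, cub2. rewrite !glue_right by (assumption || ring). tauto.
Qed.

Lemma cub_neg (t : R) : t <= 0 -> cub t = 0 /\ cub1 t = 0 /\ cub2 t = 0.
Proof.
  intros Ht; unfold cub, cub1, cub2. rewrite !glue_left by assumption. tauto.
Qed.

Lemma cub_ge_0 (t : R) : 0 <= cub t.
Proof.
  destruct (Rle_dec 0 t) as [Ht|Ht].
  - rewrite (proj1 (cub_nonneg t Ht)). apply pow_le, Ht.
  - rewrite (proj1 (cub_neg t ltac:(lra))). lra.
Qed.

(** The one-variable parts of [C * usum - k * psi], as functions of [F x] or [F y]: linear from
    [usum], quadratic from its square, cubic from the corner terms. *)
Lemma C2fun_cubic_poly (p q r : R) :
  C2fun (fun t => p * t + q * t ^ 2 + r * cub t) (fun t => p + 2 * q * t + r * cub1 t)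
        (fun t => 2 * q + r * cub2 t).
Proof.
  eapply C2fun_ext.
  - exact (C2fun_plus _ _ _ _ _ _
      (C2fun_mult _ _ _ _ _ _ (C2fun_affine 0 1) (C2fun_affine p q)) (C2fun_scal r _ _ _ C2fun_cub)).
  - intros x; simpl; ring.
  - intros x; simpl; ring.
  - intros x; simpl; ring.
Qed.

(* The relation between [a = F x] and [P = wt x * (F' x)^2 / lam]. *)
Definition slope (s a P : R) : Prop := (0 <= a /\ P = 1 - a ^ 2) \/ (a < 0 /\ P = s ^ 2 - a ^ 2).

Lemma wt_slope (lam s x : R) :
  1 <= s -> Rabs x <= halfw s ->
  exists P, slope s (prof s x) P /\ wt lam (lam * s ^ 2) x * (prof1 s x) ^ 2 = lam * P.
Proof.
  intros Hs Hx. unfold wt. destruct (Rle_dec (Rabs x) (PI / 2)) as [Bx|Bx].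
  - exists (1 - (prof s x) ^ 2). destruct (prof_inner s x Bx) as (_ & _ & ->).
    split; [left; split; [apply prof_pos_inner, Bx | reflexivity] | reflexivity].
  - exists (s ^ 2 - (prof s x) ^ 2). destruct (prof_outer s x) as (_ & _ & ->); [lra..|].
    split; [right; split; [apply prof_neg_outer; lra | reflexivity] | field; lra].
Qed.

(* Contribution of the summand [cub (F x)] of [psi] to
   [(wt x * psi_xx + wt y * psi_yy + lam * psi) / lam], at [a = F x]. *)
Definition cub_defect (a P : R) : R := P * cub2 a - a * cub1 a + cub a.

Lemma cub_defect_nonneg (a : R) : 0 <= a -> cub_defect a (1 - a ^ 2) = 6 * a - 8 * a ^ 3.
Proof. intros Ha; unfold cub_defect. destruct (cub_nonneg a Ha) as (-> & -> & ->). ring. Qed.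

Lemma cub_defect_neg (a P : R) : a <= 0 -> cub_defect a P = 0.
Proof. intros Ha; unfold cub_defect. destruct (cub_neg a Ha) as (-> & -> & ->). ring. Qed.

(** The right side minus the left is [4 (1 - a)^2 (2a + 1) + 6 (1 - a)(a + 2)]. At [a = 1], where
    the slope of the profile vanishes, both sides are [- 2]: this is the gain from the cube. *)
Lemma cubic_tangent (a : R) : 0 <= a <= 1 -> 6 * a - 8 * a ^ 3 <= -2 + 18 * (1 - a ^ 2).
Proof.
  intros Ha. assert (0 <= (1 - a) ^ 2 * (2 * a + 1)) by (apply Rmult_le_pos; [apply pow2_ge_0 | lra]).
  assert (0 <= (1 - a) * a) by nra. nra.
Qed.

(** The expression is [- L psi / lam] for [L = wt x d_xx + wt y d_yy + lam], so [psi] is a strict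
    supersolution near the boundary. The cases are the signs of the two profiles, which cannot both
    be negative. *)
Lemma defect_pos (s g a b P Q : R) :
  1 <= s -> 1 <= g * s -> g <= s -> a <= 1 -> b <= 1 -> slope s a P -> slope s b Q ->
  0 < g * a + b < 1 / 6 ->
  0 < 18 * (g ^ 2 * P + Q) - cub_defect a P - cub_defect b Q - 1 - 9 * (g * a + b) ^ 2.
Proof.
  intros Hs Hg1 Hg2 Ha1 Hb1 HP HQ Hu. assert (Hg : 0 < g) by nra.
  set (u := g * a + b) in *.
  assert (Hu2 : 0 <= u ^ 2 <= 1 / 36) by (split; [apply pow2_ge_0 | nra]).
  assert (Hg2' : g ^ 2 <= s ^ 2) by nra.
  assert (Hs2 : 1 <= s ^ 2) by nra.
  assert (Hgs : 1 <= g ^ 2 * s ^ 2) by nra.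
  destruct HP as [[Ha ->]|[Ha ->]], HQ as [[Hb ->]|[Hb ->]].
  (* Both non-negative: [b < 1 / 6], so [18 * Q >= 17.5] outweighs all negative terms. *)
  - rewrite !cub_defect_nonneg by assumption.
    pose proof (cubic_tangent a (conj Ha Ha1)).
    assert (Hga : 0 <= g * a) by nra.
    assert (b < 1 / 6) by (unfold u in Hu; lra).
    assert (0 <= g ^ 2 * (1 - a ^ 2)) by (apply Rmult_le_pos; nra).
    assert (6 * a - 8 * a ^ 3 <= 2).
    { assert (0 <= (2 * a - 1) ^ 2 * (a + 1)) by (apply Rmult_le_pos; [apply pow2_ge_0 | lra]). nra. }
    assert (0 <= b ^ 3) by (apply pow_le; lra). assert (b ^ 2 <= 1 / 36) by nra. lra.
  (* Opposite signs: after eliminating [b = u - g * a], the bounds [s >= g] and [s >= 1] leave at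
     least [18 * (1 - a ^ 2)] of gradient, and [cubic_tangent] bounds the total below by
     [2 - 1 - 27 * u ^ 2], where [27 * u ^ 2 <= 3 / 4]. In the mirror case [g * s >= 1] does
     this. *)
  - rewrite cub_defect_nonneg, cub_defect_neg by lra.
    pose proof (cubic_tangent a (conj Ha Ha1)).
    assert (Eb : b ^ 2 = g ^ 2 * a ^ 2 - 2 * u * (g * a) + u ^ 2) by (unfold u; ring).
    assert (0 <= u * (g * a)) by (apply Rmult_le_pos; nra).
    assert (0 <= 1 - a ^ 2) by nra.
    assert (0 <= g ^ 2 * (1 - a ^ 2)) by (apply Rmult_le_pos; nra).
    assert (0 <= (s ^ 2 - g ^ 2) * a ^ 2) by (apply Rmult_le_pos; nra).
    assert (0 <= (s ^ 2 - 1) * (1 - a ^ 2)) by (apply Rmult_le_pos; lra).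
    rewrite Eb. lra.
  - rewrite cub_defect_nonneg, cub_defect_neg by lra.
    pose proof (cubic_tangent b (conj Hb Hb1)).
    assert (Ea : g ^ 2 * a ^ 2 = b ^ 2 - 2 * u * b + u ^ 2) by (unfold u; ring).
    assert (0 <= u * b) by (apply Rmult_le_pos; lra).
    assert (0 <= 1 - b ^ 2) by nra.
    replace (g ^ 2 * (s ^ 2 - a ^ 2)) with (g ^ 2 * s ^ 2 - g ^ 2 * a ^ 2) by ring.
    rewrite Ea. lra.
  - exfalso. unfold u in Hu. nra.
Qed.

(** * The comparison function near the boundary *)

Lemma continuity_2d_comp_fst (h h1 h2 : R -> R) (x y : R) :
  C2fun h h1 h2 -> continuity_2d_pt (fun u _ => h u) x y.
Proof.
  intros H. apply (continuity_1d_2d_pt_comp h (fun u _ => u));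
    [exact (C2fun_continuity _ _ _ _ H) | apply continuity_2d_pt_id1].
Qed.

Lemma continuity_2d_comp_snd (h h1 h2 : R -> R) (x y : R) :
  C2fun h h1 h2 -> continuity_2d_pt (fun _ v => h v) x y.
Proof.
  intros H. apply (continuity_1d_2d_pt_comp h (fun _ v => v));
    [exact (C2fun_continuity _ _ _ _ H) | apply continuity_2d_pt_id2].
Qed.

Definition psi (s g x y : R) : R := 1 + cub (prof s x) + cub (prof s y) - 9 * usum s g x y ^ 2.

Lemma continuity_psi (s g x y : R) : s <> 0 -> continuity_2d_pt (psi s g) x y.
Proof.
  intros Hs. pose proof (C2fun_comp _ _ _ _ _ _ (C2fun_prof s Hs) C2fun_cub) as H.
  apply continuity_2d_pt_minus.
  - apply continuity_2d_pt_plus; [|exact (continuity_2d_comp_snd _ _ _ x y H)].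
    apply continuity_2d_pt_plus; [apply continuity_2d_pt_const | exact (continuity_2d_comp_fst _ _ _ x y H)].
  - apply continuity_2d_pt_mult; [apply continuity_2d_pt_const|].
    apply (continuity_1d_2d_pt_comp (fun t => t ^ 2)); [|apply continuity_usum, Hs].
    eapply is_derive_continuity_pt. auto_derive; trivial; reflexivity.
Qed.

Lemma psi_pos (s g x y : R) : 0 <= usum s g x y <= 1 / 6 -> 0 < psi s g x y.
Proof.
  intros Hu. unfold psi. pose proof (cub_ge_0 (prof s x)). pose proof (cub_ge_0 (prof s y)).
  assert (usum s g x y ^ 2 <= 1 / 36) by nra. lra.
Qed.

(** For the linear operator [L] with weights [wt], [L usum = 0] and [L psi < 0]. So
    [L (C * usum - k * psi) > 0], and such a function cannot touch a supersolution from below. *)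
Lemma no_touch_near_boundary (lam s g C k x y : R) (v : R -> R -> R) :
  0 < lam -> 1 <= s -> 1 <= g * s -> g <= s ->
  visc_super lam (lam * s ^ 2) lam (inside s g) v ->
  inside s g x y -> usum s g x y < 1 / 6 -> 0 < k ->
  v x y = C * usum s g x y - k * psi s g x y ->
  locally_2d (fun a b => inside s g a b -> C * usum s g a b - k * psi s g a b <= v a b) x y ->
  False.
Proof.
  intros Hl Hs Hg1 Hg2 Hv Hin Hu Hk Ev Hloc. assert (Hs0 : s <> 0) by lra.
  pose proof (le_mult_sqr lam s Hl Hs) as HL. set (Lam := lam * s ^ 2) in *.
  pose proof (C2fun_prof s Hs0) as F.
  (* [C * usum - k * psi] in [sepf] form, without its constant [- k]: expanding [9 * k * usum ^ 2]
     gives the quadratic terms and the product with coefficient [18 * k * g]. *)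
  assert (T := super_touch lam Lam lam (inside s g) v _ _ _ _ _ _ _ _ _ _ _ _ x y Hl HL Hv
    (C2fun_comp _ _ _ _ _ _ F (C2fun_cubic_poly (C * g) (9 * k * g ^ 2) (- k)))
    (C2fun_comp _ _ _ _ _ _ F (C2fun_cubic_poly C (9 * k) (- k)))
    (C2fun_scal (18 * k * g) _ _ _ F) F Hin).
  destruct Hin as (Hx & Hy & Hu0).
  destruct (wt_slope lam s x Hs) as [P [HP EP]]; [lra|].
  destruct (wt_slope lam s y Hs) as [Q [HQ EQ]]; [lra|].
  pose proof (wt_prof2 lam s x Hs0) as E1. pose proof (wt_prof2 lam s y Hs0) as E2.
  fold Lam in EP, EQ, E1, E2.
  pose proof (defect_pos s g _ _ P Q Hs Hg1 Hg2 (prof_le_1 s x Hs ltac:(lra))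
    (prof_le_1 s y Hs ltac:(lra)) HP HQ (conj Hu0 Hu)) as D.
  unfold cub_defect in D.
  cbv beta in T. rewrite Ev in T. clear Ev.
  set (al := wt lam Lam x) in *. set (be := wt lam Lam y) in *.
  unfold psi, usum in T.
  set (a := prof s x) in *. set (b := prof s y) in *.
  set (a1 := prof1 s x) in *. set (b1 := prof1 s y) in *.
  set (a2 := prof2 s x) in *. set (b2 := prof2 s y) in *.
  assert (H : lam * k * (18 * (g ^ 2 * P + Q) - (P * cub2 a - a * cub1 a + cub a)
     - (Q * cub2 b - b * cub1 b + cub b) - 1 - 9 * (g * a + b) ^ 2) <= 0).
  { eapply Rle_trans; [|apply T].
    - right.
      transitivity ((18 * k * g ^ 2 - k * cub2 a) * (lam * P) + (18 * k - k * cub2 b) * (lam * Q)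
        + (C * g + 18 * k * g ^ 2 * a - k * cub1 a + 18 * k * g * b) * (- lam * a)
        + (C + 18 * k * b - k * cub1 b + 18 * k * g * a) * (- lam * b)
        + lam * (C * (g * a + b) - k * (1 + cub a + cub b - 9 * (g * a + b) ^ 2))); [ring|].
      rewrite <- EP, <- EQ, <- E1, <- E2. ring.
    - destruct Hloc as [r Hr]. exists r; intros c d Hc Hd Hcd. specialize (Hr c d Hc Hd Hcd).
      unfold psi, usum in Hr. unfold sepf. fold a b. lra. }
  assert (0 < lam * k) by (apply Rmult_lt_0_compat; assumption).
  apply (Rlt_not_le _ _ (Rmult_lt_0_compat _ _ H0 D)). exact H.
Qed.

(** [N / D > m] is [N - m * D > 0], which reduces the quotient to differences. *)
Lemma lsc_on_div (K : R -> R -> Prop) (N D : R -> R -> R) :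
  (forall x y, K x y -> 0 < D x y) -> (forall x y, continuity_2d_pt D x y) ->
  (forall m, lsc_on K (fun x y => N x y - m * D x y)) -> lsc_on K (fun x y => N x y / D x y).
Proof.
  intros HD HC HN x y Hk m Hm. apply Rlt_div_r in Hm; [|apply HD, Hk].
  destruct (HN m x y Hk 0) as [d Hd]; [lra|]. exists d; intros a b Ha Hb Hab.
  specialize (Hd a b Ha Hb Hab). apply Rlt_div_r; [apply HD, Hab | lra].
Qed.

Lemma inside_cl_sub_closed (s g : R) (Q : R -> Prop) (x y : R) :
  s <> 0 -> (forall t, ~ Q t -> exists d : posreal, forall t', Rabs (t' - t) < d -> ~ Q t') ->
  ~ (inside_cl s g x y /\ Q (usum s g x y)) ->
  locally_2d (fun u v => ~ (inside_cl s g u v /\ Q (usum s g u v))) x y.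
Proof.
  intros Hs HQ Hn. destruct (classic (inside_cl s g x y)) as [Hc|Hc].
  - destruct (HQ (usum s g x y)) as [d Hd]; [tauto|].
    destruct (continuity_usum s g x y Hs d) as [r Hr].
    exists r; intros u v Hu Hv [_ H]. exact (Hd _ (Hr u v Hu Hv) H).
  - destruct (inside_cl_closed s g x y Hs Hc) as [r Hr].
    exists r; intros u v Hu Hv [H _]. exact (Hr u v Hu Hv H).
Qed.

(** Compactness gives the margin [eps] where [usum >= 1 / 6]. Minimising [(v - C * usum) / psi]
    carries it to the boundary, since [no_touch_near_boundary] excludes a negative minimum. *)
Lemma strict_improvement (lam s g c : R) (v : R -> R -> R) :
  0 < lam -> 1 <= s -> 1 <= g * s -> g <= s ->
  visc_super lam (lam * s ^ 2) lam (inside s g) v ->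
  (forall x y, inside s g x y -> 0 < v x y) ->
  (forall x y, inside s g x y -> c * usum s g x y < v x y) ->
  exists eps, 0 < eps /\ forall x y, inside s g x y -> (c + eps) * usum s g x y <= v x y.
Proof.
  intros Hl Hs Hg1 Hg2 Hv Hpos Hlt. assert (Hs0 : s <> 0) by lra. assert (Hg : 0 < g) by nra.
  assert (Cv : forall x y, inside s g x y -> continuity_2d_pt v x y).
  { intros x y Hxy. apply (cont_on_continuity (inside s g)); [apply Hv | apply inside_open; assumption]. }
  assert (Bd : forall x y, inside_cl s g x y -> Rabs x <= halfw s /\ Rabs y <= halfw s).
  { intros x y (Hx & Hy & _); tauto. }
  set (K1 := fun x y => inside_cl s g x y /\ 1 / 6 <= usum s g x y).
  assert (K1in : forall x y, K1 x y -> inside s g x y).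
  { intros x y [H1 H2]. apply inside_of_cl; try assumption; lra. }
  destruct (lsc_attains_min K1 (fun x y => (v x y - c * usum s g x y) / usum s g x y) (halfw s) 0 0)
    as (x0 & y0 & HK0 & Hmin).
  { destruct (inside_0 s g Hs Hg) as (H1 & H2 & H3). split; [repeat split; lra|].
    unfold usum; rewrite prof_0; lra. }
  { intros x y [H _]; apply Bd, H. }
  { intros x y H. apply (inside_cl_sub_closed s g (fun t => 1 / 6 <= t)); [exact Hs0 | | exact H].
    intros t Ht. assert (Hd : 0 < 1 / 6 - t) by lra. exists (mkposreal _ Hd); intros t' Ht'.
    apply Rabs_def2 in Ht'; simpl in Ht'; lra. }
  { apply lsc_on_div.
    - intros x y [_ H]; lra.
    - intros x y; apply continuity_usum, Hs0.
    - intros m. apply lsc_of_continuity. intros x y Hxy.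
      apply continuity_2d_pt_minus; [apply continuity_2d_pt_minus; [apply Cv, K1in, Hxy|]|];
        (apply continuity_2d_pt_mult; [apply continuity_2d_pt_const | apply continuity_usum, Hs0]). }
  set (eps := (v x0 y0 - c * usum s g x0 y0) / usum s g x0 y0) in *.
  assert (Heps : 0 < eps).
  { unfold eps. apply Rdiv_lt_0_compat; [|destruct HK0; lra].
    specialize (Hlt x0 y0 (K1in _ _ HK0)); lra. }
  exists eps; split; [exact Heps|].
  set (C := c + eps).
  assert (HK1 : forall x y, K1 x y -> C * usum s g x y <= v x y).
  { intros x y Hxy. specialize (Hmin x y Hxy). destruct Hxy as [_ H].
    apply Rle_div_r in Hmin; [unfold C; lra | lra]. }
  (* The extension of [v] by 0 allows minimising over a compact set that includes the boundary. *)
  set (vb := fun x y => if excluded_middle_informative (inside s g x y) then v x y else 0).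
  assert (vb_in : forall x y, inside s g x y -> vb x y = v x y).
  { intros x y H; unfold vb; destruct (excluded_middle_informative (inside s g x y)); tauto. }
  assert (vb_ge : forall x y, 0 <= vb x y).
  { intros x y; unfold vb; destruct (excluded_middle_informative (inside s g x y)) as [H|H];
      [left; apply Hpos, H | lra]. }
  set (K2 := fun x y => inside_cl s g x y /\ usum s g x y <= 1 / 6).
  assert (Pp : forall x y, K2 x y -> 0 < psi s g x y).
  { intros x y [(_ & _ & H1) H2]. apply psi_pos; lra. }
  assert (K2min : forall x y, K2 x y -> 0 <= vb x y - C * usum s g x y).
  { intros x y Hxy.
    destruct (lsc_attains_min K2 (fun x y => (vb x y - C * usum s g x y) / psi s g x y) (halfw s) x y)
      as (x1 & y1 & HK & Hm); [exact Hxy | | | |].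
    { intros a b [H _]; apply Bd, H. }
    { intros a b H. apply (inside_cl_sub_closed s g (fun t => t <= 1 / 6)); [exact Hs0 | | exact H].
      intros t Ht. assert (Hd : 0 < t - 1 / 6) by lra. exists (mkposreal _ Hd); intros t' Ht'.
      apply Rabs_def2 in Ht'; simpl in Ht'; lra. }
    { apply lsc_on_div; [exact Pp | intros a b; apply continuity_psi, Hs0 |].
      intros m a b Hab n Hn.
      assert (Cc : forall f, continuity_2d_pt f a b ->
        continuity_2d_pt (fun a b => f a b - C * usum s g a b - m * psi s g a b) a b).
      { intros f Hf. apply continuity_2d_pt_minus; [apply continuity_2d_pt_minus; [exact Hf|]|];
          (apply continuity_2d_pt_mult; [apply continuity_2d_pt_const|]);
          [apply continuity_usum, Hs0 | apply continuity_psi, Hs0]. }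
      destruct (classic (inside s g a b)) as [Hi|Hi].
      - rewrite vb_in in Hn by exact Hi.
        apply (locally_2d_impl (fun p q => n < v p q - C * usum s g p q - m * psi s g p q)).
        + apply (locally_2d_impl (inside s g)); [|apply inside_open; assumption].
          apply locally_2d_forall. intros p q Hpq H _. rewrite vb_in by exact Hpq. exact H.
        + apply (continuity_2d_lt _ n a b (Cc v (Cv a b Hi)) Hn).
      (* Off the open domain [vb] is 0, so replacing [vb] by 0 gives a continuous minorant with the
         same value at this point. *)
      - assert (E : vb a b = 0).
        { unfold vb; destruct (excluded_middle_informative (inside s g a b)); [contradiction | reflexivity]. }
        rewrite E in Hn.
        destruct (continuity_2d_lt _ n a b (Cc (fun _ _ => 0) (continuity_2d_pt_const a b 0)) Hn) as [r Hr].
        exists r; intros p q Hp Hq _. specialize (Hr p q Hp Hq). specialize (vb_ge p q). simpl in Hr. lra. }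
    simpl in Hm.
    destruct (Rle_dec 0 ((vb x1 y1 - C * usum s g x1 y1) / psi s g x1 y1)) as [H0|H0].
    { assert (H1 : 0 <= (vb x y - C * usum s g x y) / psi s g x y) by (eapply Rle_trans; [exact H0 | apply Hm, Hxy]).
      apply Rle_div_r in H1; [lra | apply Pp, Hxy]. }
    (* A negative minimum is neither on the boundary, where [vb >= 0 = usum], nor on [usum = 1 / 6],
       where [HK1] applies. With [k] minus the minimum, [C * usum - k * psi] touches [v] there. *)
    exfalso.
    assert (HN : vb x1 y1 - C * usum s g x1 y1 < 0).
    { apply Rnot_le_lt; intros H; apply H0. apply Rdiv_le_0_compat; [exact H | apply Pp, HK]. }
    pose proof HK as [HKa HKb].
    assert (Hi : inside s g x1 y1).
    { apply NNPP; intros Hi.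
      assert (usum s g x1 y1 = 0).
      { destruct HKa as (Hx1 & Hy1 & Hu1). apply Rle_antisym; [|exact Hu1].
        apply Rnot_lt_le; intros H. apply Hi, inside_of_cl; try assumption. repeat split; assumption. }
      specialize (vb_ge x1 y1). rewrite H in HN. lra. }
    assert (Hu1 : usum s g x1 y1 < 1 / 6).
    { destruct HKb as [|E]; [assumption|]. rewrite vb_in in HN by exact Hi.
      specialize (HK1 x1 y1). assert (K1 x1 y1) by (split; [exact HKa | lra]). specialize (HK1 H). lra. }
    assert (P1 : 0 < psi s g x1 y1) by (apply Pp, HK).
    set (k := - ((vb x1 y1 - C * usum s g x1 y1) / psi s g x1 y1)).
    apply (no_touch_near_boundary lam s g C k x1 y1 v); try assumption.
    - unfold k; lra.
    - rewrite <- vb_in by exact Hi. unfold k; field; lra.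
    - destruct (continuity_2d_gt (usum s g) (1 / 6) x1 y1 (continuity_usum s g x1 y1 Hs0) Hu1) as [r Hr].
      exists r; intros a b Ha Hb Hab. specialize (Hr a b Ha Hb).
      assert (HKab : K2 a b).
      { destruct Hab as (H1 & H2 & H3). split; [repeat split|]; lra. }
      assert (Hf : (vb x1 y1 - C * usum s g x1 y1) / psi s g x1 y1
        <= (vb a b - C * usum s g a b) / psi s g a b) by (apply Hm, HKab).
      rewrite (vb_in a b Hab) in Hf. apply Rle_div_r in Hf; [|apply Pp, HKab].
      unfold k; lra. }
  intros x y Hxy. destruct (Rle_dec (1 / 6) (usum s g x y)) as [H|H].
  - apply HK1. destruct Hxy as (H1 & H2 & H3). split; [repeat split|]; lra.
  - rewrite <- vb_in by exact Hxy. assert (HK : K2 x y).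
    { destruct Hxy as (H1 & H2 & H3). split; [repeat split|]; lra. }
    specialize (K2min x y HK). lra.
Qed.

Theorem supersolution_unique (lam s g : R) (v : R -> R -> R) :
  0 < lam -> 1 <= s -> 1 <= g * s -> g <= s ->
  visc_super lam (lam * s ^ 2) lam (inside s g) v ->
  (forall x y, inside s g x y -> 0 < v x y) ->
  exists c, 0 < c /\ forall x y, inside s g x y -> v x y = c * usum s g x y.
Proof.
  intros Hl Hs Hg1 Hg2 Hv Hpos. assert (Hg : 0 < g) by nra.
  pose proof (inside_0 s g Hs Hg) as H0. pose proof (proj2 (proj2 H0)) as Hu0.
  set (E := fun c => forall x y, inside s g x y -> c * usum s g x y <= v x y).
  destruct (completeness E) as [c [Hub Hlub]].
  - exists (v 0 0 / usum s g 0 0). intros c Hc. apply Rle_div_r; [exact Hu0 | apply Hc, H0].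
  - exists 0. intros x y Hxy. rewrite Rmult_0_l. left; apply Hpos, Hxy.
  (* Each inequality bounds the constant by [v / usum] at one point, so the supremum belongs to
     [E]. *)
  - assert (Hc : E c).
    { intros x y Hxy. pose proof (proj2 (proj2 Hxy)) as Hu. apply Rle_div_r; [exact Hu|].
      apply Hlub. intros c' Hc'. apply Rle_div_r; [exact Hu | apply Hc', Hxy]. }
    assert (Heq : forall x y, inside s g x y -> v x y = c * usum s g x y).
    { intros x y Hxy. apply NNPP; intros Hne.
      assert (Hlt : forall x y, inside s g x y -> c * usum s g x y < v x y).
      { apply (strong_minimum lam s g c v); try assumption.
        exists x, y; split; [exact Hxy|]. specialize (Hc x y Hxy). lra. }
      destruct (strict_improvement lam s g c v Hl Hs Hg1 Hg2 Hv Hpos Hlt) as [eps [He Hce]].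
      specialize (Hub (c + eps) Hce). lra. }
    exists c; split; [|exact Heq].
    specialize (Hpos 0 0 H0). rewrite (Heq 0 0 H0) in Hpos.
    apply Rmult_lt_reg_r with (usum s g 0 0); [exact Hu0 | rewrite Rmult_0_l; exact Hpos].
Qed.

(** * Principal eigenvalue and eigenfunction *)

Lemma visc_super_le (lam Lam mu mu' : R) (O : Defs.domain) (v : R -> R -> R) :
  (forall x y, O x y -> 0 < v x y) -> mu <= mu' ->
  visc_super lam Lam mu' O v -> visc_super lam Lam mu O v.
Proof.
  intros Hp Hmu [Hc H]. split; [exact Hc|]. intros phi x y Hphi Hxy Hmin.
  specialize (H phi x y Hphi Hxy Hmin). specialize (Hp x y Hxy).
  assert (mu * v x y <= mu' * v x y) by (apply Rmult_le_compat_r; lra). lra.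
Qed.

Lemma closure_inside (s g x y : R) : s <> 0 -> Defs.closure (inside s g) x y -> inside_cl s g x y.
Proof.
  intros Hs Hc. apply NNPP; intros Hn. destruct (inside_cl_closed s g x y Hs Hn) as [d Hd].
  destruct (Hc d (cond_pos d)) as (a & b & (H1 & H2 & H3) & Hab). apply box_lt_of_dist2 in Hab.
  apply (Hd a b); [tauto | tauto |]. repeat split; lra.
Qed.

Theorem theorem2p2 (lam Lam gam : R) :
  0 < lam -> lam <= Lam ->
  let om := Lam / lam in
  1 / sqrt om <= gam -> gam <= sqrt om ->
  principal_eigenvalue lam Lam (Omega_og om gam) lam /\
  principal_eigenfunction lam Lam (Omega_og om gam) lam (u_og om gam) /\
  (forall v, principal_eigenfunction lam Lam (Omega_og om gam) lam v ->
     exists c, 0 < c /\ forall x y, Omega_og om gam x y -> v x y = c * u_og om gam x y).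
Proof.
  intros Hl HL om Hg1 Hg2.
  assert (Hom : 1 <= om) by (apply Rle_div_r; lra).
  set (s := sqrt om) in *.
  assert (Hs : 1 <= s) by (rewrite <- sqrt_1; apply sqrt_le_1_alt, Hom).
  assert (Hg1' : 1 <= gam * s) by (apply Rle_div_l in Hg1; lra).
  assert (Hg : 0 < gam) by nra. assert (Hs0 : s <> 0) by lra.
  assert (EL : Lam = lam * s ^ 2).
  { unfold s. rewrite pow2_sqrt by lra. unfold om; field; lra. }
  assert (EO : Omega_og om gam = inside s gam).
  { apply functional_extensionality; intros x; apply functional_extensionality; intros y.
    apply propositional_extensionality, Omega_og_inside; assumption. }
  rewrite EO, EL.
  assert (Eu : forall x y, inside_cl s gam x y -> u_og om gam x y = usum s gam x y).
  { intros x y; apply u_og_usum; assumption. }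
  assert (Eu' : forall x y, inside s gam x y -> u_og om gam x y = usum s gam x y).
  { intros x y (H1 & H2 & H3); apply Eu; repeat split; lra. }
  pose proof (usum_visc_sol lam s gam Hl Hs Hg) as Hsol.
  pose proof (inside_0 s gam Hs Hg) as H0.
  split; [split|split].
  (* A candidate with [mu > lam] is a supersolution at level [lam], hence equal to [c * usum].
     Tested by itself at the origin, it gives [(mu - lam) * c * usum 0 0 <= 0], which is absurd. *)
  - intros mu (phi & Hpos & Hsup). apply Rnot_lt_le; intros Hmu.
    destruct (supersolution_unique lam s gam phi Hl Hs Hg1' Hg2) as (c & Hc & E); [| exact Hpos |].
    + apply (visc_super_le _ _ _ mu); [exact Hpos | lra | exact Hsup].
    + pose proof (C2fun_prof s Hs0) as F.
      assert (T := super_touch lam (lam * s ^ 2) mu (inside s gam) phi _ _ _ _ _ _ _ _ _ _ _ _ 0 0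
        Hl (le_mult_sqr lam s Hl Hs) Hsup (C2fun_scal (c * gam) _ _ _ F) (C2fun_scal c _ _ _ F)
        (C2fun_const 0) (C2fun_const 0) H0).
      assert (Hw : - lam * (c * usum s gam 0 0) + mu * (c * usum s gam 0 0) <= 0).
      { rewrite <- (E 0 0 H0) at 2. eapply Rle_trans; [|apply T].
        - right. unfold usum. pose proof (wt_prof2 lam s 0 Hs0) as W.
          transitivity (c * (gam + 1) * (- lam * prof s 0) + mu * phi 0 0); [ring|].
          rewrite <- W. ring.
        - exists (mkposreal 1 Rlt_0_1); intros a b _ _ Hab.
          rewrite (E 0 0 H0), (E a b Hab). unfold sepf, usum. lra. }
      assert (0 < c * usum s gam 0 0) by (apply Rmult_lt_0_compat; [exact Hc | apply H0]).
      nra.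
  - intros b Hb. apply Hb. exists (usum s gam). split; [intros x y H; apply H | apply Hsol].
  - split; [|split; [|split]].
    + intros x y H. rewrite Eu' by exact H. apply H.
    + intros x y Hxy eps He.
      destruct (cont_on_of_continuity (Defs.closure (inside s gam)) (usum s gam)
        (fun a b => continuity_usum s gam a b Hs0) x y Hxy eps He) as [d [Pd Hd]].
      exists d; split; [exact Pd|]. intros a b Hab Hdist.
      rewrite !Eu by (apply closure_inside; assumption). auto.
    (* A boundary point is in [inside_cl] but not in [inside], so by [inside_of_cl] the value of
       [usum] there cannot be positive. *)
    + intros x y [Hcl Hn]. apply closure_inside in Hcl; [|exact Hs0]. rewrite Eu by exact Hcl.
      apply Rle_antisym; [|apply Hcl]. apply Rnot_lt_le; intros H.
      apply Hn, inside_of_cl; assumption.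
    + apply (visc_sol_ext _ _ _ _ (usum s gam)); [|exact Hsol].
      intros x y H; symmetry; apply Eu', H.
  - intros v (Hpos & _ & _ & [Hsup _]).
    destruct (supersolution_unique lam s gam v Hl Hs Hg1' Hg2 Hsup Hpos) as (c & Hc & E).
    exists c; split; [exact Hc|]. intros x y H. rewrite Eu', E by exact H. reflexivity.
Qed.
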